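(* Let $p$ be prime, let $\lambda_p=2-\frac1p$, and for $n\ge1$ let $\sigma_n\sim\mathrm{Unif}(B_n^{(p)})$. Then $W_n^{(p)}=C(\sigma_n)\cdot\lambda_p^{-n}$ converges in distribution, as $n\to\infty$, to a random variable $W^{(p)}$ with support on $(0,\infty)$ satisfying $\mathbb E[(W^{(p)})^k]=m_k^{(p)}$ for all positive integers $k$, where $m_0^{(p)}=m_1^{(p)}=1$ and, for $k\ge2$, \[ m_k^{(p)}=\frac1{p-1}\,\frac{\lambda_p-1}{\lambda_p^k-\lambda_p}\sum_{\substack{i_1+\cdots+i_p=k\\ i_1,\ldots,i_p<k}}\binom{k}{i_1,\ldots,i_p}\prod_{\ell=1}^p m_{i_\ell}^{(p)}, \] the sum being over nonnegative integers $i_1,\dots,i_p$.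
   Context: $C(\sigma)$ is the number of cycles in the disjoint cycle decomposition of $\sigma$ (fixed points counted as cycles). For permutations, $\oplus$ and $\otimes$ are defined via permutation matrices ($P_\sigma\mathbf e_k=\mathbf e_{\sigma(k)}$): $P_{\sigma\oplus\tau}=P_\sigma\oplus P_\tau$ (block diagonal) and $P_{\sigma\otimes\tau}=P_\sigma\otimes P_\tau$ (Kronecker product); $1_k$ is the identity of $S_k$. Let $\tau_p=(1\ 2\ \cdots\ p)\in S_p$. The group $B_n^{(p)}\subset S_{p^n}$ of nonsimple $p$-nary butterfly permutations is defined by $B_1^{(p)}=\langle\tau_p\rangle$ and, for $n\ge2$, $B_n^{(p)}=\{(\sigma_\theta\otimes1_{p^{n-1}})(\sigma_1\oplus\cdots\oplus\sigma_p):\sigma_\theta\in\langle\tau_p\rangle,\ \sigma_j\in B_{n-1}^{(p)}\}$; it is a $p$-Sylow subgroup of $S_{p^n}$. *)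

(* Defs.v *)
From HB Require Import structures.
From mathcomp Require Import all_boot all_order all_algebra fingroup perm.
From mathcomp Require Import mxtens.

Set Implicit Arguments.
Unset Strict Implicit.
Unset Printing Implicit Defensive.

Import Order.TTheory GRing.Theory Num.Theory.

Local Open Scope ring_scope.

(* Sends the k-th basis column vector to the (s k)-th one; this is the         *)
(* transpose of the library's [perm_mx s], which acts on row vectors.          *)
Definition permutation_matrix (n : nat) (s : 'S_n) : 'M[int]_n :=
  \matrix_(i, j) (i == s j)%:R.

Section KroneckerProduct.
Variables (m n : nat) (s : 'S_m) (t : 'S_n).

Definition perm_tens_fun (k : 'I_(m * n)) : 'I_(m * n) :=
  mxtens_index (s (mxtens_unindex k).1, t (mxtens_unindex k).2).

Lemma perm_tens_fun_inj : injective perm_tens_fun.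
Proof.
move=> k l; case: (mxtens_indexP k) => a b; case: (mxtens_indexP l) => c d.
rewrite /perm_tens_fun !mxtens_indexK.
by move=> /(can_inj (@mxtens_indexK m n)) [/perm_inj -> /perm_inj ->].
Qed.

Definition perm_tens : 'S_(m * n) := perm perm_tens_fun_inj.

Lemma permutation_matrix_tens :
  permutation_matrix perm_tens =
  tensmx (permutation_matrix s) (permutation_matrix t).
Proof.
apply/matrixP => i j; case: (mxtens_indexP i) => i1 i2.
case: (mxtens_indexP j) => j1 j2.
rewrite tensmxE !mxE permE /perm_tens_fun mxtens_indexK /=.
by rewrite (can_eq (@mxtens_indexK m n)) xpair_eqE -natrM mulnb.
Qed.

End KroneckerProduct.

Section DirectSum.
Variables (m n : nat) (s : 'I_m -> 'S_n).

Definition perm_dsum_fun (k : 'I_(m * n)) : 'I_(m * n) :=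
  mxtens_index
    ((mxtens_unindex k).1, s (mxtens_unindex k).1 (mxtens_unindex k).2).

Lemma perm_dsum_fun_inj : injective perm_dsum_fun.
Proof.
move=> k l; case: (mxtens_indexP k) => a b; case: (mxtens_indexP l) => c d.
rewrite /perm_dsum_fun !mxtens_indexK.
by move=> /(can_inj (@mxtens_indexK m n)) [/= -> /perm_inj ->].
Qed.

Definition perm_dsum : 'S_(m * n) := perm perm_dsum_fun_inj.

Lemma sum_ord_const : (\sum_(i < m) n = m * n)%N.
Proof. by rewrite sum_nat_const card_ord. Qed.

Lemma permutation_matrix_dsum :
  permutation_matrix perm_dsum =
  castmx (sum_ord_const, sum_ord_const)
    (\mxdiag_(i < m) permutation_matrix (s i)).
Proof.
have Rk (a : 'I_m) (b : 'I_n) :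
    cast_ord (esym sum_ord_const) (mxtens_index (a, b)) = tagnat.Rank a b.
  apply: val_inj; rewrite [RHS]tagnat.RankEsum; congr (_ + _)%N.
  rewrite sum_nat_const; congr (_ * _)%N.
  rewrite -sum1_card -[LHS]card_ord -sum1_card.
  by rewrite (big_ord_widen m (fun=> 1%N)) // ltnW.
apply/matrixP => i j; case: (mxtens_indexP i) => a b.
case: (mxtens_indexP j) => c d.
rewrite castmxE !Rk.
pose D := \mxdiag_(i < m) permutation_matrix (s i).
have -> : D (tagnat.Rank a b) (tagnat.Rank c d) = submxblock D a c b d.
  by rewrite [RHS]mxE.
rewrite /D /mxdiag mxblockK !mxE permE /perm_dsum_fun mxtens_indexK /=.
rewrite (can_eq (@mxtens_indexK m n)) xpair_eqE.
case: (altP (a =P c)) => [<-|_] /=; last by rewrite mxE.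
by rewrite conform_mx_id mxE.
Qed.

End DirectSum.

Definition tau (p : nat) : 'S_p := perm (@ordS_inj p).

(* The product in ['S_n] applies its left factor first, so it is the reverse   *)
(* of composition of functions.                                                *)
Lemma permutation_matrixM (n : nat) (s t : 'S_n) :
  permutation_matrix (t * s)%g = permutation_matrix s *m permutation_matrix t.
Proof.
apply/matrixP => i j; rewrite !mxE (bigD1 (t j)) //= big1 => [|k ktj].
  by rewrite !mxE permM eqxx mulr1 addr0.
by rewrite !mxE (negbTE ktj) mulr0.
Qed.

Definition butterfly_step (p n : nat) (B : {set 'S_(p ^ n)}) :
    {set 'S_(p ^ n.+1)} :=
  [set cast_perm (esym (expnS p n))
         (perm_dsum s * perm_tens theta (1 : 'S_(p ^ n)))%g |
     theta : 'S_p in <[tau p]>%g, s : {ffun 'I_p -> 'S_(p ^ n)} in ffun_on (mem B)].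

(* Only the values at n >= 1 are meaningful.                                   *)
Fixpoint butterfly (p n : nat) : {set 'S_(p ^ n)} :=
  match n return {set 'S_(p ^ n)} with
  | 0 => [set 1%g]
  | n'.+1 =>
      match n' return {set 'S_(p ^ n')} -> {set 'S_(p ^ n'.+1)} with
      | 0 => fun=> <[tau p]>%g
      | _.+1 => fun B => butterfly_step B
      end (butterfly p n')
  end.

Definition cycle_count (n : nat) (s : 'S_n) : nat := #|porbits s|.

(* Loaded only here because its notations for classical sets shadow those for  *)
(* finite sets.                                                                *)
From mathcomp Require Import all_classical all_reals all_analysis.
Import numFieldNormedType.Exports.
Local Open Scope classical_set_scope.

HB.instance Definition _ (I : finType) :=
  isPointed.Build (perm_type I) (1 : {perm I})%g.

HB.instance Definition _ (I : finType) :=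
  @isMeasurable.Build default_measure_display (perm_type I) discrete_measurable
    discrete_measurable0 discrete_measurableC discrete_measurableU.

Definition uniform_on (R : realType) (d : measure_display)
    (T : measurableType d) (P : probability T R) (n : nat)
    (X : {RV P >-> 'S_n}) (A : {set 'S_n}) : Prop :=
  forall s : 'S_n,
    distribution P X [set s] = (if s \in A then #|A|%:R^-1 else 0)%:E.

Definition cvg_in_distribution (R : realType) (d : nat -> measure_display)
    (T : forall n, measurableType (d n)) (P : forall n, probability (T n) R)
    (X : forall n, {RV (P n) >-> R}) (d' : measure_display)
    (T' : measurableType d') (P' : probability T' R) (Y : {RV P' >-> R}) :
    Prop :=
  forall x : R, {for x, continuous (cdf Y)} ->
    cdf (X n) x @[n --> \oo] --> cdf Y x.

Definition lambda (R : realType) (p : nat) : R := 2 - p%:R^-1.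

Definition scaled_cycle_count (R : realType) (p n : nat) (s : 'S_(p ^ n)) : R :=
  (cycle_count s)%:R * lambda R p ^- n.

Lemma measurable_scaled_cycle_count (R : realType) (p n : nat) :
  measurable_fun [set: 'S_(p ^ n)] (@scaled_cycle_count R p n).
Proof. by []. Qed.

HB.instance Definition _ (R : realType) (p n : nat) :=
  isMeasurableFun.Build _ _ _ _ (@scaled_cycle_count R p n)
    (@measurable_scaled_cycle_count R p n).

(* Main.v *)
Require Import Defs.
From HB Require Import structures.
From mathcomp Require Import all_boot all_order all_algebra fingroup perm.
From mathcomp Require Import cyclic mxtens ring lra.

(** In the wreath product description of a butterfly permutation, a nontrivial
    [theta] is a [p]-cycle of the blocks since [p] is prime, and then the cycles
    of the whole permutation are those of the product of its blocks, a uniform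
    element of the smaller group. If [theta] is trivial, the numbers of cycles
    of the [p] independent blocks add up. So the number of cycles has the law of
    the [n]-th generation of a Galton-Watson process with [p] children with
    probability [1 / p] and one child otherwise, whose mean is [lambda]
    ([cycle_poly_butterfly], an identity of generating functions).

    The normalized generations [W_n] form a martingale, so for each [x] the
    excess [E (W_n - x)^+] increases with [n] ([gmean_excess_nondecreasing]) and
    converges to a convex function of [x]. Minus its right derivative is the
    tail of a probability measure ([limit_law]), and the tails of [W_n], being
    squeezed between slopes of the excess functions, converge to it at its
    continuity points ([limit_tail_cvg]).

    Splitting at the first generation gives an affine recursion for the moments
    of [W_n] whose fixed point is the recursion of the statement
    ([gmean_expr_cvg]). Since all moments are bounded, the tails of the powers
    of [W_n] are uniformly integrable, and the moments pass to the limit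
    ([expectation_pos_partX]).

    Finally, the same splitting bounds the mass of [W_n] near [0]: it satisfies
    [q <= q ^ p / p + (1 - 1 / p) * q] up to a rescaling, and by the second
    moment it is bounded away from [1], hence it tends to [0] uniformly in [n]
    ([lower_tail_small]). So the limit is almost surely positive ([tail0]). *)

Set Implicit Arguments.
Unset Strict Implicit.
Unset Printing Implicit Defensive.

Import Order.TTheory GRing.Theory Num.Theory.

Local Open Scope ring_scope.

(** * Cycles of wreath products *)

(** Counting classes instead of sets: two maps out of [T] with the same fibers
    have images of the same size. This is how cycles of different permutations
    are matched below. *)
Lemma card_imset_eq_fibers (T A B : finType) (f : T -> A) (g : T -> B) :
  (forall x y, f x = f y <-> g x = g y) -> #|f @: T| = #|g @: T|.
Proof.
move=> fg; pose h x := (f x, g x).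
have cf : #|fst @: (h @: T)| = #|h @: T|.
  apply: card_in_imset => _ _ /imsetP[x _ ->] /imsetP[y _ ->] /= e.
  by rewrite /h e; move/fg: e => ->.
have cg : #|snd @: (h @: T)| = #|h @: T|.
  apply: card_in_imset => _ _ /imsetP[x _ ->] /imsetP[y _ ->] /= e.
  by rewrite /h e; move/fg: e => ->.
by move: cf cg; rewrite -!imset_comp => -> ->.
Qed.

Lemma eq_porbitP (T : finType) (s : {perm T}) x y :
  porbit s x = porbit s y <-> exists i, y = (s ^+ i)%g x.
Proof.
rewrite (rwP eqP) eq_porbit_mem porbit_sym.
by split=> [/porbitP|/porbitP].
Qed.

Lemma card_porbits_conj (T U : finType) (h : T -> U) (s : {perm T})
    (t : {perm U}) : bijective h -> (forall x, h (s x) = t (h x)) ->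
  #|porbits s| = #|porbits t|.
Proof.
move=> [k hK kK] hs.
have hX i x : h ((s ^+ i)%g x) = (t ^+ i)%g (h x).
  by elim: i => [|i IH]; rewrite ?expg0 ?perm1 // !expgSr !permM hs IH.
have -> : porbits t = (fun x => porbit t (h x)) @: T.
  apply/setP=> O; apply/imsetP/imsetP => -[x _ ->]; last by exists (h x).
  by exists (k x); rewrite ?kK.
apply: card_imset_eq_fibers => x y; rewrite !eq_porbitP.
by split=> -[i e]; exists i; [rewrite e hX | apply: (can_inj hK); rewrite hX].
Qed.

Section Wreath.
Variables (I T : finType).
Implicit Types (theta : {perm I}) (s : I -> {perm T}).

Definition wreath_fun theta s (x : I * T) := (theta x.1, s x.1 x.2).

Lemma wreath_fun_inj theta s : injective (wreath_fun theta s).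
Proof. by case=> a b [c d] [/perm_inj <- /perm_inj ->]. Qed.

(** An element of the wreath product acting on the blocks [I] and inside them:
    [s a] moves the points of block [a], then [theta] moves the block. *)
Definition wreath theta s : {perm I * T} := perm (@wreath_fun_inj theta s).

Lemma wreathX theta s i a b : (wreath theta s ^+ i)%g (a, b) =
  ((theta ^+ i)%g a, (\prod_(j < i) s ((theta ^+ j)%g a))%g b).
Proof.
elim: i => [|i IH]; first by rewrite !expg0 big_ord0 !perm1.
by rewrite big_ord_recr /= !expgSr !permM IH permE /wreath_fun.
Qed.

(** Without a permutation of the blocks each orbit stays inside one block [a],
    where it is an orbit of [s a]. *)
Lemma card_porbits_wreath1 s :
  #|porbits (wreath 1 s)| = (\sum_a #|porbits (s a)|)%N.
Proof.
pose g (x : I * T) := (x.1, porbit (s x.1) x.2).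
have wX i x y : (wreath 1 s ^+ i)%g (x, y) = (x, (s x ^+ i)%g y).
  rewrite wreathX expg1n perm1; congr (_, _).
  by under eq_bigr do rewrite expg1n perm1; rewrite prodg_const card_ord.
have -> : #|porbits (wreath 1 s)| = #|[set g x | x : I * T]|.
  apply: card_imset_eq_fibers => -[a b] [c d]; rewrite eq_porbitP /g /=.
  split=> [[i]|[<-] /eq_porbitP[i ->]]; last by exists i; rewrite wX.
  by rewrite wX => -[-> ->]; congr (_, _); apply/eq_porbitP; exists i.
rewrite -sum1_card (eq_bigl (fun y => y.2 \in porbits (s y.1))).
  rewrite -(pair_big_dep xpredT (fun a O => O \in porbits (s a)) (fun _ _ => 1%N)).
  by apply: eq_bigr => a _; rewrite sum1_card.
move=> [a O] /=; apply/imsetP/imsetP => [[[c d] _ [-> ->]]|[x _ ->]].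
  by exists d.
by exists (a, x).
Qed.

(** If [theta] is a single cycle of length [q], every orbit meets the block [a],
    and it returns there exactly every [q] steps. So orbits correspond to those
    of the return map to that block, which is the product of the [s c] in the
    order in which [theta] visits the blocks. *)
Lemma card_porbits_wreath_cycle theta s (q : nat) (a : I) :
    (forall i, (theta ^+ i)%g a = a -> (q %| i)%N) ->
    (theta ^+ q)%g a = a ->
    (forall c, exists i, (theta ^+ i)%g c = a) ->
  #|porbits (wreath theta s)| =
  #|porbits (\prod_(j < q) s ((theta ^+ j)%g a))%g|.
Proof.
move=> thetaq thetaqa thetac; set r := (\prod_(j < q) _)%g.
have wX i b : (wreath theta s ^+ (q * i))%g (a, b) = (a, (r ^+ i)%g b).
  elim: i => [|i IH]; first by rewrite muln0 !expg0 !perm1.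
  by rewrite mulnS addnC expgD permM IH wreathX thetaqa -/r expgSr permM.
have -> : porbits (wreath theta s) =
    [set porbit (wreath theta s) (a, b) | b : T].
  apply/setP=> O; apply/imsetP/imsetP => [[[c d] _ ->]|[b _ ->]]; last first.
    by exists (a, b).
  have [i ica] := thetac c.
  exists ((\prod_(j < i) s ((theta ^+ j)%g c))%g d) => //.
  by apply/eq_porbitP; exists i; rewrite wreathX ica.
apply: card_imset_eq_fibers => b c; rewrite !eq_porbitP; split=> -[i e].
  have qi : (q %| i)%N by apply: thetaq; move: e; rewrite wreathX => -[].
  exists (i %/ q)%N; move: e; rewrite -{1}(divnK qi) mulnC wX.
  by move=> -[].
by exists (q * i)%N; rewrite wX -e.
Qed.

Lemma wreathM theta s theta' s' : (wreath theta s * wreath theta' s')%g =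
  wreath (theta * theta')%g (fun a => s a * s' (theta a))%g.
Proof. by apply/permP => -[a b]; rewrite permM !permE /wreath_fun /= !permM. Qed.

End Wreath.

(** * The butterfly groups as iterated wreath products *)

Lemma tauX p i (a : 'I_p) : ((tau p ^+ i)%g a = (a + i) %% p :> nat)%N.
Proof.
elim: i => [|i IH]; first by rewrite expg0 perm1 addn0 modn_small.
by rewrite expgSr permM permE /= IH addnS -!(addn1 (_ + _)) -(addn1 (_ %% _)) modnDml.
Qed.

Lemma order_tau p : (0 < p)%N -> #[tau p]%g = p.
Proof.
case: p => // p _; apply/eqP; rewrite eqn_dvd order_dvdn.
apply/andP; split.
  by apply/eqP/permP=> a; apply: val_inj; rewrite /= tauX perm1 modnDr modn_small.
have := congr1 val (congr1 (fun t : 'S_p.+1 => t ord0) (expg_order (tau p.+1))).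
by rewrite /= tauX perm1 add0n => /eqP.
Qed.

(** As [p] is prime, every nontrivial power of [tau p] has order [p] and moves
    every point. *)
Lemma cycle_tau_free p (theta : 'S_p) i a : prime p ->
  theta \in <[tau p]>%g -> theta != 1%g ->
  ((theta ^+ i)%g a == a) = (p %| i)%N.
Proof.
move=> pp /cycleP[r ->] r1; have p0 := prime_gt0 pp.
have npr : ~~ (p %| r)%N.
  by apply: contra r1 => pr; rewrite -order_dvdn order_tau.
rewrite -expgM -val_eqE /= tauX -{2}(modn_small (ltn_ord a)).
by rewrite -{2}(addn0 a) eqn_modDl mod0n -/(dvdn _ _) Euclid_dvdM // (negbTE npr).
Qed.

(** The first [p] iterates are distinct by [cycle_tau_free], hence exhaust
    ['I_p]. *)
Lemma cycle_tau_transitive p (theta : 'S_p) a c : prime p ->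
  theta \in <[tau p]>%g -> theta != 1%g -> exists i, (theta ^+ i)%g c = a.
Proof.
move=> pp thetat theta1.
have inj : injective (fun i : 'I_p => (theta ^+ i)%g c).
  move=> i j; wlog ij : i j / (i <= j)%N.
    by move=> H; case: (leqP i j) => [/H|/ltnW /H h e]; [|apply/esym/h].
  rewrite -(subnKC ij) expgD permM => /esym/eqP.
  rewrite cycle_tau_free // => /dvdn_leq; case: posnP => [z _|]; last first.
    by move=> _ /(_ isT); rewrite leqNgt (leq_ltn_trans (leq_subr _ _)).
  by apply: val_inj => /=; apply/eqP; rewrite eqn_leq ij -subn_eq0 z.
have [g _ gK] := injF_bij inj.
by exists (g a); rewrite gK.
Qed.

Lemma card_porbits1 (T : finType) : #|porbits (1 : {perm T})%g| = #|T|.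
Proof.
apply: card_imset => x y /eq_porbitP[i ->].
by rewrite expg1n perm1.
Qed.

Lemma sum_cycle_tau_neq1 (V : nmodType) (x : V) p : (0 < p)%N ->
  \sum_(theta in <[tau p]>%g | theta != 1%g) x = x *+ p.-1.
Proof.
move=> p0; rewrite sumr_const; congr (_ *+ _).
have /= := cardD1 (1%g : 'S_p) (<[tau p]>%g).
rewrite -[#|<[_]>%g|]/#[_]%g order_tau // group1 add1n.
move/(congr1 predn) => /= ->; by apply: eq_card => t; rewrite !inE andbC.
Qed.

Section ButterflyStep.
Variables p n : nat.
Local Notation N := (p ^ n)%N.

(** Identifies the points of [p] blocks of size [p ^ n] with ['I_(p ^ n.+1)], so
    that all the casts and tensor indices of [butterfly_step] are confined to
    [block_permE]. *)
Definition block_index (x : 'I_p * 'I_N) : 'I_(p ^ n.+1) :=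
  cast_ord (esym (expnS p n)) (mxtens_index x).

Lemma block_index_bij : bijective block_index.
Proof.
exists (fun i => mxtens_unindex (cast_ord (expnS p n) i)) => x.
  by rewrite /block_index cast_ordKV mxtens_indexK.
by rewrite /block_index mxtens_unindexK cast_ordK.
Qed.

Definition block_perm (theta : 'S_p) (s : 'I_p -> 'S_N) : 'S_(p ^ n.+1) :=
  cast_perm (esym (expnS p n)) (perm_dsum s * perm_tens theta (1 : 'S_N))%g.

Lemma block_permE theta s x :
  block_perm theta s (block_index x) = block_index (wreath theta s x).
Proof.
case: x => a b; rewrite /block_perm -cast_ord_permE permM !permE.
by rewrite /perm_dsum_fun /perm_tens_fun !mxtens_indexK /= perm1.
Qed.

Lemma eq_block_perm theta s (t : 'S_(p ^ n.+1)) :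
  (forall x, t (block_index x) = block_index (wreath theta s x)) ->
  t = block_perm theta s.
Proof.
have [k hK kK] := block_index_bij.
by move=> ht; apply/permP=> i; rewrite -(kK i) ht block_permE.
Qed.

Lemma cycle_count_block_perm theta s :
  cycle_count (block_perm theta s) = #|porbits (wreath theta s)|.
Proof.
apply/esym/(card_porbits_conj block_index_bij) => x.
by rewrite block_permE.
Qed.

Lemma block_permM theta s theta' s' :
  (block_perm theta s * block_perm theta' s')%g =
  block_perm (theta * theta')%g (fun a => s a * s' (theta a))%g.
Proof.
by apply: eq_block_perm => x; rewrite permM !block_permE -permM wreathM.
Qed.

Lemma block_perm1 : block_perm 1%g (fun=> 1%g) = 1%g.
Proof.
apply/esym/eq_block_perm => -[a b].
by rewrite perm1 permE /wreath_fun /= !perm1.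
Qed.

Lemma eq_block_perml theta s t :
  s =1 t -> block_perm theta s = block_perm theta t.
Proof.
move=> st; apply: eq_block_perm => x; rewrite block_permE.
by rewrite !permE /wreath_fun st.
Qed.

Lemma block_perm_inj (p_gt0 : (0 < p)%N) :
  injective (fun u : 'S_p * {ffun 'I_p -> 'S_N} => block_perm u.1 u.2).
Proof.
have N0 : (0 < N)%N by rewrite expn_gt0 p_gt0.
case=> theta s [theta' s'] /= e.
have W a b : wreath theta s (a, b) = wreath theta' s' (a, b).
  by apply: (bij_inj block_index_bij); rewrite -!block_permE e.
congr (_, _).
  by apply/permP=> a; have := W a (Ordinal N0); rewrite !permE => -[].
by apply/ffunP=> a; apply/permP=> b; have := W a b; rewrite !permE => -[].
Qed.

Variable B : {set 'S_N}.

Lemma butterfly_stepP t : reflect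
  (exists theta, exists2 s : {ffun 'I_p -> 'S_N},
    theta \in <[tau p]>%g /\ s \in ffun_on (mem B) & t = block_perm theta s)
  (t \in butterfly_step B).
Proof.
apply: (iffP imset2P) => [[theta s thetat sB ->]|[theta [s [thetat sB] ->]]].
  by exists theta; exists s.
by exists theta s.
Qed.

Lemma group_set_butterfly_step : group_set B -> group_set (butterfly_step B).
Proof.
case/group_setP=> B1 BM; apply/group_setP; split.
  apply/butterfly_stepP; exists 1%g; exists [ffun=> 1%g].
    by split; [exact: group1 | apply/ffun_onP => a; rewrite ffunE].
  by rewrite -block_perm1; apply: eq_block_perml => a; rewrite ffunE.
move=> _ _ /butterfly_stepP[theta [s [thetat /ffun_onP sB] ->]]
  /butterfly_stepP[theta' [s' [thetat' /ffun_onP sB'] ->]].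
apply/butterfly_stepP; exists (theta * theta')%g.
exists [ffun a => s a * s' (theta a)]%g.
  by split; [exact: groupM | apply/ffun_onP => a; rewrite ffunE BM].
by rewrite block_permM; apply: eq_block_perml => a; rewrite ffunE.
Qed.

Lemma sum_butterfly_step (V : nmodType) (F : 'S_(p ^ n.+1) -> V) :
  (0 < p)%N ->
  \sum_(t in butterfly_step B) F t =
  \sum_(theta in <[tau p]>%g) \sum_(s in ffun_on (mem B)) F (block_perm theta s).
Proof.
move=> p0; rewrite pair_big /=.
pose A := [pred u : 'S_p * {ffun 'I_p -> 'S_N} |
  (u.1 \in <[tau p]>%g) && (u.2 \in ffun_on (mem B))].
rewrite -[RHS](@big_imset _ _ _ _ _
  (fun u : 'S_p * {ffun 'I_p -> 'S_N} => block_perm u.1 u.2) A); last first.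
  by move=> u v _ _; exact: block_perm_inj.
apply: eq_bigl => t; apply/butterfly_stepP/imsetP.
  by case=> theta [s [? ?] ->]; exists (theta, s) => //; apply/andP.
by case=> -[theta s] /andP[? ?] ->; exists theta; exists s.
Qed.

Lemma card_butterfly_step : (0 < p)%N -> #|butterfly_step B| = (p * #|B| ^ p)%N.
Proof.
move=> p0; rewrite -sum1_card sum_butterfly_step //.
under eq_bigr do rewrite sum1_card card_ffun_on.
by rewrite sum_nat_const -[#|<[_]>%g|]/#[_]%g order_tau // card_ord.
Qed.

End ButterflyStep.

(** * The law of the number of cycles *)

Section CyclePolynomial.
Variables (R : comNzRingType).

(** Divided by [#|B|], this is the probability generating function of the
    number of cycles of a uniform element of [B]. *)
Definition cycle_poly n (B : {set 'S_n}) : {poly R} :=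
  \sum_(s in B) 'X^(cycle_count s).

Lemma sum_ffun_on_coordinate (I T : finType) (B : {pred T}) (a : I)
    (F : T -> {poly R}) :
  \sum_(s : {ffun I -> T} | s \in ffun_on B) F (s a) =
  (#|B| ^ #|I|.-1)%:R * \sum_(x in B) F x.
Proof.
pose G i x := if i == a then F x else 1.
transitivity (\prod_(i : I) \sum_(x in B) G i x).
  rewrite bigA_distr_big; apply: eq_bigr => s _.
  by rewrite (bigD1 a) //= /G eqxx big1 ?mulr1 // => i /negbTE ->.
rewrite (bigD1 a) //= mulrC; congr (_ * _).
  rewrite (eq_bigr (fun=> #|B|%:R)); last first.
    by move=> i /negbTE ia; rewrite /G ia -sumr_const.
  by rewrite prodr_const natrX cardC1.
by rewrite /G eqxx.
Qed.

(** In a finite group [s a * g] is as uniform as [s a], even if the translation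
    [g = f s] depends on the other coordinates of [s]. *)
Lemma sum_ffun_on_translate (I : finType) n (B : {set 'S_n}) (a : I)
    (f : {ffun I -> 'S_n} -> 'S_n) (F : 'S_n -> {poly R}) : group_set B ->
    (forall s, s \in ffun_on (mem B) -> f s \in B) ->
    (forall s t : {ffun I -> 'S_n}, (forall i, i != a -> s i = t i) -> f s = f t) ->
  \sum_(s : {ffun I -> 'S_n} | s \in ffun_on (mem B)) F (s a * f s)%g =
  (#|B| ^ #|I|.-1)%:R * \sum_(x in B) F x.
Proof.
move=> gB fB fa; rewrite -(sum_ffun_on_coordinate _ a).
have /group_setP[B1 BM] := gB.
have BV x : x \in B -> (x^-1)%g \in B := @groupVr _ (Group gB) x.
(* Multiplication by g in the coordinate a; f does not see this change. *)
pose h g (s : {ffun I -> 'S_n}) := [ffun i => if i == a then s a * g s else s i]%g.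
have hE g s i : i != a -> h g s i = s i by move=> /negbTE ia; rewrite ffunE ia.
have fh g s : f (h g s) = f s by apply: fa => i; exact: hE.
pose g s := ((f s)^-1)%g.
have hgK s : h f (h g s) = s.
  apply/ffunP => i; rewrite ffunE fh; case: eqVneq => [->|ia]; last exact: hE.
  by rewrite ffunE eqxx mulgKV.
have hfK s : h g (h f s) = s.
  apply/ffunP => i; rewrite ffunE /g fh; case: eqVneq => [->|ia]; last exact: hE.
  by rewrite ffunE eqxx mulgK.
rewrite [RHS](reindex_onto (h f) (h g)) => [|s _]; last exact: hgK.
apply: eq_big => [s|s _]; last by rewrite ffunE eqxx.
rewrite hfK eqxx andbT; apply/idP/idP => /ffun_onP sB; apply/ffun_onP => i.
  rewrite ffunE; case: ifP => // _; apply: BM => //.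
  by apply: fB; exact/ffun_onP.
rewrite -[s]hfK ffunE; case: eqVneq => [_|_]; last exact: sB.
by apply: BM => //; apply: BV; apply: fB; exact/ffun_onP.
Qed.

(** The trivial [theta] contributes [p] independent numbers of cycles that add
    up. Each of the [p.-1] others contributes the number of cycles of a product
    of all [p] blocks, which is uniform in the group [B]. *)
Lemma cycle_poly_butterfly_step p n (B : {set 'S_(p ^ n)}) : prime p ->
    group_set B ->
  cycle_poly (butterfly_step B) =
  cycle_poly B ^+ p + (p.-1 * #|B| ^ p.-1)%:R * cycle_poly B.
Proof.
move=> pp gB; have p0 := prime_gt0 pp.
rewrite /cycle_poly sum_butterfly_step // (bigD1 1%g) ?group1 //=.
congr (_ + _).
  under eq_bigr do rewrite cycle_count_block_perm card_porbits_wreath1.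
  transitivity (\prod_(i : 'I_p) \sum_(s in B) ('X^(cycle_count s) : {poly R})).
    2: by rewrite prodr_const card_ord.
  rewrite bigA_distr_big; apply: eq_bigr => s _; rewrite -prodrXr.
  by rewrite -(big_morph _ (exprD _) (expr0 _)).
pose a : 'I_p := Ordinal p0.
rewrite (eq_bigr (fun=> (#|B| ^ p.-1)%:R * \sum_(s in B) 'X^(cycle_count s))).
  rewrite sum_cycle_tau_neq1 //.
  by rewrite natrM -mulrA [RHS]mulr_natl.
move=> theta /andP[thetat theta1].
pose f (s : {ffun 'I_p -> 'S_(p ^ n)}) :=
  (\prod_(1 <= j < p) s ((theta ^+ j)%g a))%g.
have := @sum_ffun_on_translate _ _ _ a f (fun s => 'X^(cycle_count s)) gB.
rewrite card_ord => <-.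
- apply: eq_bigr => s _; rewrite cycle_count_block_perm.
  rewrite (@card_porbits_wreath_cycle _ _ _ _ p a) //.
  + by rewrite /f -(big_mkord xpredT (fun j => s ((theta ^+ j)%g a))) big_ltn //
      expg0 perm1.
  + by move=> i /eqP; rewrite cycle_tau_free.
  + by apply/eqP; rewrite cycle_tau_free.
  + by move=> c; exact: cycle_tau_transitive.
- move=> s /ffun_onP sB; have /group_setP[B1 BM] := gB.
  rewrite /f; elim/big_rec: _ => // j x _ xB; apply: BM => //; exact: sB.
move=> s t st; apply: eq_big_nat => j /andP[j0 jp]; apply: st.
by rewrite cycle_tau_free // gtnNdvd //.
Qed.

(** The first generation fits the same pattern with blocks of size one. *)
Lemma cycle_poly_tau p : prime p ->
  cycle_poly <[tau p]>%g = 'X^p + p.-1%:R * 'X.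
Proof.
move=> pp; have p0 := prime_gt0 pp; pose s (_ : 'I_p) : {perm unit} := 1%g.
have C theta : cycle_count theta = #|porbits (wreath theta s)|.
  apply: (@card_porbits_conj _ _ (fun a : 'I_p => (a, tt))).
    by exists (fun x : 'I_p * unit => x.1); [|case=> ? []].
  by move=> b; rewrite permE /wreath_fun /s perm1.
rewrite /cycle_poly (bigD1 1%g) ?group1 //= /cycle_count card_porbits1 card_ord.
congr (_ + _).
rewrite (eq_bigr (fun=> 'X)) => [|theta /andP[thetat theta1]].
  by rewrite sum_cycle_tau_neq1 // mulr_natl.
rewrite -[RHS]expr1; congr ('X^_); rewrite [LHS]C.
rewrite (@card_porbits_wreath_cycle _ _ _ _ p (Ordinal p0)) //.
+ by rewrite big1 // card_porbits1 card_unit.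
+ by move=> i /eqP; rewrite cycle_tau_free.
+ by apply/eqP; rewrite cycle_tau_free.
+ by move=> c; exact: cycle_tau_transitive.
Qed.

End CyclePolynomial.

Lemma group_set_butterfly p n : group_set (butterfly p n).
Proof.
elim: n => [|[|n] IH]; first exact: group_set_one.
  exact: (groupP <[tau p]>%g).
exact: group_set_butterfly_step.
Qed.

(** * The Galton-Watson process *)

Section GaltonWatson.
Variables (R : numFieldType) (p : nat).

(** An individual has [p] children with probability [1 / p], and one child
    otherwise. *)
Definition offspring : {poly R} := p%:R^-1 *: 'X^p + (1 - p%:R^-1) *: 'X.

(** The generating function of the size of the [n]-th generation of the
    Galton-Watson process started from one individual. *)
Definition generation (n : nat) : {poly R} :=
  iter n (fun f => offspring \Po f) 'X.

Lemma generationS n : generation n.+1 =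
  p%:R^-1 *: generation n ^+ p + (1 - p%:R^-1) *: generation n.
Proof.
by rewrite /generation iterS -/(generation n) /offspring
  comp_polyD !comp_polyZ comp_Xn_poly comp_polyX.
Qed.

(** [generationS] splits the process at its first generation; this splits it at
    the last one. *)
Lemma generationSr n : generation n.+1 = generation n \Po offspring.
Proof.
elim: n => [|n IH]; first by rewrite /generation /= comp_polyX comp_polyXr.
by rewrite -[LHS]/(offspring \Po generation n.+1) {1}IH comp_polyA.
Qed.

Lemma cycle_poly_butterfly n : prime p ->
  cycle_poly R (butterfly p n) = #|butterfly p n|%:R *: generation n.
Proof.
move=> pp; have p0 := prime_gt0 pp.
have pN0 : p%:R != 0 :> R by rewrite pnatr_eq0 -lt0n.
have p1 : p.-1%:R = p%:R * (1 - p%:R^-1) :> R.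
  by rewrite mulrBr divff // mulr1 -subn1 natrB.
elim: n => [|[|n] IH].
- rewrite /cycle_poly /= big_set1 cards1 scale1r.
  by rewrite /cycle_count card_porbits1 card_ord.
- rewrite [LHS]cycle_poly_tau // generationS /=.
  rewrite -[#|<[_]>%g|]/#[_]%g order_tau // scalerDr !scalerA divff // scale1r.
  by rewrite -p1 scaler_nat mulr_natl.
have gB := group_set_butterfly p n.+1.
have b0 : #|butterfly p n.+1|%:R != 0 :> R.
  by rewrite pnatr_eq0 -lt0n; apply/card_gt0P; exists 1%g; case/group_setP: gB.
rewrite -[butterfly p n.+2]/(butterfly_step (butterfly p n.+1)).
rewrite cycle_poly_butterfly_step // IH card_butterfly_step //.
rewrite (generationS n.+1) exprZn scalerDr !scalerA !natrM !natrX.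
rewrite -natrX -natrM mulr_natl -scaler_nat scalerA natrM natrX p1.
set b := #|_|%:R; have bp : b ^+ p = b * b ^+ p.-1 by rewrite -exprS prednK.
congr (_ *: _ + _ *: _); first by rewrite mulrAC divff // mul1r.
by rewrite bp; ring.
Qed.

End GaltonWatson.

From mathcomp Require Import all_classical all_reals all_analysis.
From mathcomp Require Import measurable_realfun.
Import numFieldNormedType.Exports.

Local Open Scope classical_set_scope.
Local Open Scope ring_scope.

(** * Expectations read off generating functions *)

Section Mean.
Variable R : realFieldType.
Implicit Types (f g h : {poly R}) (phi psi : R -> R) (c t x y : R).

(** The expectation of [phi (c * N)] if [f] is the probability generating
    function of the random number [N]. Finite sums over coefficients make a
    probability space superfluous until the limit is taken. *)
Definition mean c phi f : R := \sum_(i < size f) f`_i * phi (c * i%:R).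

Lemma mean_widen c phi f n : (size f <= n)%N ->
  mean c phi f = \sum_(i < n) f`_i * phi (c * i%:R).
Proof.
move=> fn; rewrite /mean (big_ord_widen n (fun i => f`_i * phi (c * i%:R))) //.
rewrite big_mkcond; apply: eq_bigr => i _; case: ltnP => // fi.
by rewrite nth_default // mul0r.
Qed.

Lemma meanD c phi f g : mean c phi (f + g) = mean c phi f + mean c phi g.
Proof.
pose n := maxn (size f) (size g).
rewrite !(@mean_widen _ _ _ n) ?leq_maxl ?leq_maxr ?size_polyD // -big_split.
by apply: eq_bigr => i _; rewrite coefD mulrDl.
Qed.

Lemma mean0 c phi : mean c phi 0 = 0.
Proof. by rewrite /mean size_poly0 big_ord0. Qed.

Lemma meanZ c phi a f : mean c phi (a *: f) = a * mean c phi f.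
Proof.
rewrite (mean_widen _ _ (size_scale_leq a f)) mulr_sumr.
by apply: eq_bigr => i _; rewrite coefZ mulrA.
Qed.

Lemma mean_sum c phi (I : Type) (r : seq I) (P : pred I) (F : I -> {poly R}) :
  mean c phi (\sum_(i <- r | P i) F i) = \sum_(i <- r | P i) mean c phi (F i).
Proof. exact: (big_morph _ (meanD c phi) (mean0 c phi)). Qed.

Lemma meanXn c phi n : mean c phi 'X^n = phi (c * n%:R).
Proof.
rewrite /mean size_polyXn big_ord_recr /= coefXn eqxx mul1r big1 ?add0r //.
by move=> i _; rewrite coefXn ltn_eqF // mul0r.
Qed.

Lemma mean_comp c phi f g :
  mean c phi (f \Po g) = \sum_(i < size f) f`_i * mean c phi (g ^+ i).
Proof. by rewrite comp_polyE mean_sum; apply: eq_bigr => i _; rewrite meanZ. Qed.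

(** A product of generating functions belongs to the sum of independent random
    variables. *)
Lemma meanM c phi f g :
  mean c phi (f * g) = mean c (fun x => mean c (fun y => phi (x + y)) g) f.
Proof.
rewrite -{1}[f]coefK poly_def mulr_suml mean_sum; apply: eq_bigr => i _.
rewrite -scalerAl meanZ; congr (_ * _).
rewrite -{1}[g]coefK poly_def mulr_sumr mean_sum; apply: eq_bigr => j _.
by rewrite -scalerAr meanZ -exprD meanXn natrD mulrDr.
Qed.

Lemma eq_mean c phi psi f : phi =1 psi -> mean c phi f = mean c psi f.
Proof. by move=> e; apply: eq_bigr => i _; rewrite e. Qed.

Lemma mean_funD c phi psi f :
  mean c (fun x => phi x + psi x) f = mean c phi f + mean c psi f.
Proof. by rewrite /mean -big_split; apply: eq_bigr => i _; rewrite mulrDr. Qed.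

Lemma mean_funZ c a phi f : mean c (fun x => a * phi x) f = a * mean c phi f.
Proof. by rewrite /mean mulr_sumr; apply: eq_bigr => i _; rewrite mulrCA. Qed.

Lemma mean_fun_sum c n (phi : 'I_n -> R -> R) f :
  mean c (fun x => \sum_(i < n) phi i x) f = \sum_(i < n) mean c (phi i) f.
Proof.
rewrite /mean exchange_big; apply: eq_bigr => i _ /=.
by rewrite mulr_sumr.
Qed.

Lemma mean_rescale c a phi f : mean (a * c) phi f = mean c (fun x => phi (a * x)) f.
Proof. by apply: eq_bigr => i _; rewrite mulrA. Qed.

Lemma mean_cst c a f : mean c (fun=> a) f = a * f.[1].
Proof.
rewrite horner_coef mulr_sumr; apply: eq_bigr => i _.
by rewrite expr1n mulr1 mulrC.
Qed.

Lemma mean_id c f : mean c id f = c * f^`().[1].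
Proof.
rewrite /deriv horner_poly mulr_sumr /mean.
case: (size f) => [|n]; first by rewrite !big_ord0.
rewrite big_ord_recl /= !mulr0 add0r; apply: eq_bigr => i _.
by rewrite expr1n mulr1 -[bump 0 i]/i.+1 -mulr_natr; ring.
Qed.

Definition is_pgf f := (forall i, 0 <= f`_i) /\ f.[1] = 1.

Lemma is_pgfM f g : is_pgf f -> is_pgf g -> is_pgf (f * g).
Proof.
move=> [f0 f1] [g0 g1]; split; last by rewrite hornerM f1 g1 mulr1.
by move=> i; rewrite coefM sumr_ge0 // => j _; rewrite mulr_ge0.
Qed.

Lemma is_pgfX n f : is_pgf f -> is_pgf (f ^+ n).
Proof.
move=> hf; elim: n => [|n IH]; last by rewrite exprS; exact: is_pgfM.
rewrite expr0; split; last by rewrite hornerC.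
by move=> i; rewrite coef1 ler0n.
Qed.

Lemma is_pgf_polyX : is_pgf 'X.
Proof. by split=> [i|]; rewrite ?hornerX // coefX ler0n. Qed.

Lemma is_pgf_mix a f g : 0 <= a <= 1 -> is_pgf f -> is_pgf g ->
  is_pgf (a *: f + (1 - a) *: g).
Proof.
move=> /andP[a0 a1] [f0 f1] [g0 g1]; split=> [i|].
  by rewrite coefD !coefZ addr_ge0 // mulr_ge0 // subr_ge0.
by rewrite hornerD !hornerZ f1 g1; ring.
Qed.

Lemma ler_mean c phi psi f : 0 <= c -> is_pgf f ->
  (forall x, 0 <= x -> phi x <= psi x) -> mean c phi f <= mean c psi f.
Proof.
move=> c0 [f0 _] le; apply: ler_sum => i _.
by rewrite ler_wpM2l // le // mulr_ge0.
Qed.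

Lemma mean_ge0 c phi f : 0 <= c -> is_pgf f ->
  (forall x, 0 <= x -> 0 <= phi x) -> 0 <= mean c phi f.
Proof.
by move=> c0 [f0 _] le; apply: sumr_ge0 => i _; rewrite mulr_ge0 // le // mulr_ge0.
Qed.

End Mean.

(** * The normalized process *)

Section GenerationMean.
Variables (R : realType) (p : nat).
Hypothesis p_gt1 : (1 < p)%N.
Local Notation lam := (lambda R p).
Local Notation pr := (p%:R : R).

Lemma p_gt1R : 1 < pr. Proof. by rewrite ltr1n. Qed.

Lemma invp_itv : 0 < pr^-1 < 1.
Proof. by have := p_gt1R => ?; rewrite invr_gt0 invf_lt1; lra. Qed.

Lemma lambda_gt1 : 1 < lam.
Proof. by rewrite /lambda; have /andP[? ?] := invp_itv; lra. Qed.

Lemma lambda_gt0 : 0 < lam. Proof. exact: lt_trans ltr01 lambda_gt1. Qed.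

Lemma is_pgf_offspring : is_pgf (offspring R p).
Proof.
apply: is_pgf_mix; [|exact/is_pgfX/is_pgf_polyX|exact: is_pgf_polyX].
by have /andP[? ?] := invp_itv; lra.
Qed.

Lemma deriv_offspring : (offspring R p)^`().[1] = lam.
Proof.
rewrite /offspring derivD !derivZ derivXn derivX !hornerE.
rewrite /lambda /= hornerMn hornerXn expr1n mulVf; last first.
  by rewrite gt_eqF // (lt_trans ltr01 p_gt1R).
by rewrite -[LHS]/(1 + 1 - pr^-1); lra.
Qed.

Lemma is_pgf_generation n : is_pgf (generation R p n).
Proof.
elim: n => [|n IH]; first exact: is_pgf_polyX.
rewrite generationS; apply: is_pgf_mix => //; last exact: is_pgfX.
by have /andP[? ?] := invp_itv; lra.
Qed.

(** The expectation of [phi] at the normalized size [Z_n / lambda ^ n] of the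
    [n]-th generation. *)
Definition gmean n phi : R := mean (lam ^- n) phi (generation R p n).

Lemma scale_ge0 n : 0 <= lam ^- n.
Proof. by rewrite invr_ge0 exprn_ge0 // ltW // lambda_gt0. Qed.

Lemma gmean_cst n a : gmean n (fun=> a) = a.
Proof.
by rewrite /gmean mean_cst; case: (is_pgf_generation n) => _ ->; rewrite mulr1.
Qed.

Lemma gmeanS n phi : gmean n.+1 phi =
  pr^-1 * mean (lam ^- n) (fun x => phi (lam^-1 * x)) (generation R p n ^+ p) +
  (1 - pr^-1) * gmean n (fun x => phi (lam^-1 * x)).
Proof.
by rewrite /gmean generationS meanD !meanZ exprS invfM !mean_rescale.
Qed.

(** The normalized process is a martingale, so expectations of convex functions
    grow. For [max (x - t) 0] Jensen's inequality is only positivity: the mean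
    of a maximum is at least the mean of either argument. It is applied to each
    power of the offspring generating function, that is, to the children of a
    generation of given size. *)
Lemma gmean_excess_nondecreasing t n :
  gmean n (fun x => Num.max (x - t) 0) <= gmean n.+1 (fun x => Num.max (x - t) 0).
Proof.
rewrite /gmean generationSr mean_comp; apply: ler_sum => i _.
have [f0 _] := is_pgf_generation n.
have hi := is_pgfX i is_pgf_offspring.
apply: ler_wpM2l => //; rewrite ge_max; apply/andP; split; last first.
  by apply: mean_ge0 => //; [exact: scale_ge0 | move=> x _; rewrite le_max lexx orbT].
(* The offspring mean lambda cancels one factor of the normalization. *)
have -> : lam ^- n * i%:R - t =
    mean (lam ^- n.+1) (fun x => x + - t) (offspring R p ^+ i).
  rewrite mean_funD mean_id mean_cst hi.2 mulr1; congr (_ + _).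
  rewrite deriv_exp hornerMn hornerM deriv_offspring.
  rewrite (is_pgfX _ is_pgf_offspring).2 mulr1.
  have := lambda_gt0; rewrite lt0r => /andP[l0 _].
  by rewrite exprSr invfM -(mulr_natr lam) mulrA divfK.
apply: ler_mean => //; first exact: scale_ge0.
by move=> x _; rewrite le_max lexx.
Qed.

Lemma gmean_id n : gmean n id = 1.
Proof.
elim: n => [|n IH].
  by rewrite /gmean mean_id derivX hornerC expr0 invr1 mulr1.
have l0 : lam != 0 by rewrite gt_eqF // lambda_gt0.
move: IH; rewrite /gmean !mean_id => IH.
rewrite generationSr deriv_comp hornerM horner_comp is_pgf_offspring.2.
rewrite deriv_offspring exprSr invfM mulrACA mulVf //.
by rewrite mulr1.
Qed.

End GenerationMean.

(** * Convergence of moments *)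

Section Egf.
Variable R : realFieldType.
Implicit Types (f g : {poly R}) (c : R) (u : nat -> R).

Definition moment c f k : R := mean c (fun x => x ^+ k) f.

(** Truncated exponential generating function of a moment sequence: sums of
    independent variables multiply these functions, up to the truncation. *)
Definition egf n u : {poly R} := \poly_(i < n) (u i / i`!%:R).

Lemma coef_egf n u k : (k < n)%N -> (egf n u)`_k = u k / k`!%:R.
Proof. by move=> kn; rewrite coef_poly kn. Qed.

(** The binomial theorem for a sum of independent variables. *)
Lemma momentM c f g k : moment c (f * g) k =
  \sum_(i < k.+1) (moment c f (k - i) * moment c g i) *+ 'C(k, i).
Proof.
rewrite /moment meanM.
transitivity (mean c (fun x => \sum_(i < k.+1)
    (moment c g i *+ 'C(k, i)) * x ^+ (k - i)) f).
  apply: eq_mean => x.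
  transitivity (mean c (fun y => \sum_(i < k.+1)
      (x ^+ (k - i) *+ 'C(k, i)) * y ^+ i) g).
    by apply: eq_mean => y; rewrite exprDn; apply: eq_bigr => i _; rewrite mulrnAl.
  rewrite mean_fun_sum; apply: eq_bigr => i _.
  by rewrite mean_funZ -/(moment c g i) mulrnAl mulrC mulrnAl.
rewrite mean_fun_sum; apply: eq_bigr => i _.
by rewrite mean_funZ mulrC mulrnAr.
Qed.

Lemma eq_coefM n f f' g : (forall k, (k < n)%N -> f`_k = f'`_k) ->
  forall k, (k < n)%N -> (f * g)`_k = (f' * g)`_k.
Proof.
move=> e k kn; rewrite !coefM; apply: eq_bigr => i _.
by rewrite e // (leq_trans (ltn_ord i)).
Qed.

Lemma coef_egfM n c f g k : (k < n)%N ->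
  (egf n (moment c (f * g)))`_k = (egf n (moment c f) * egf n (moment c g))`_k.
Proof.
move=> kn; rewrite coef_egf // momentM mulr_suml coefMr; apply: eq_bigr => i _.
have ik : (i <= k)%N by rewrite -ltnS.
rewrite !coef_egf ?(leq_ltn_trans (leq_subr _ _)) ?(leq_ltn_trans ik) //.
have fN0 j : j`!%:R != 0 :> R by rewrite pnatr_eq0 -lt0n fact_gt0.
rewrite -(bin_fact ik) !natrM -mulr_natr.
have bN0 : 'C(k, i)%:R != 0 :> R by rewrite pnatr_eq0 -lt0n bin_gt0.
by field; rewrite !fN0 bN0.
Qed.

Lemma coef_egfX n c f q k : (k < n)%N ->
  (egf n (moment c (f ^+ q)))`_k = (egf n (moment c f) ^+ q)`_k.
Proof.
elim: q k => [|q IH] k kn.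
  rewrite coef_egf // !expr0 coef1 /moment -(expr0 'X) meanXn mulr0 expr0n.
  by case: k {kn} => [|k]; rewrite ?divr1 // mul0r.
rewrite !exprSr coef_egfM //.
by apply: (eq_coefM (n := n)).
Qed.

(** Only the terms of degree at most one in [a] reach the coefficient of
    ['X^k]. *)
Lemma coef_expD_Xn f a q k : (0 < k)%N -> f`_0 = 1 ->
  ((f + a *: 'X^k) ^+ q)`_k = (f ^+ q)`_k + q%:R * a.
Proof.
move=> k0 f0; rewrite exprDn coef_sum.
case: q => [|q].
  by rewrite big_ord_recl big_ord0 /= !expr0 mulr1 mulr1n addr0 mul0r addr0.
rewrite big_ord_recl big_ord_recl /= expr0 mulr1 subn0 bin0 mulr1n.
rewrite /bump /= addn0 expr1 bin1 subSS subn0 big1 => [|i _]; last first.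
  rewrite exprZn -exprM -scalerAr -scaler_nat scalerA coefZ coefMXn.
  by rewrite !add1n mulnS mulnS addnA ifT ?mulr0 // ltn_addr // -addn1 leq_add.
rewrite addr0; congr (_ + _).
rewrite -scalerAr coefMn coefZ coefMXn ltnn subnn -horner_coef0 horner_exp.
by rewrite horner_coef0 f0 expr1n mulr1 mulr_natl.
Qed.

Lemma coef_egf_exp q k u : (egf k u ^+ q)`_k =
  \sum_(i : {ffun 'I_q -> 'I_k} | (\sum_(l < q) i l == k)%N)
    \prod_(l < q) (u (i l) / (i l)`!%:R).
Proof.
rewrite -{1}[q]card_ord -prodr_const /egf poly_def bigA_distr_bigA /= coef_sum.
rewrite [RHS]big_mkcond; apply: eq_bigr => i _.
rewrite scaler_prod coefZ prodrXr coefXn eq_sym.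
by case: eqP => _; rewrite ?mulr1 ?mulr0.
Qed.

Lemma egfS k u : egf k.+1 u = egf k u + (u k / k`!%:R) *: 'X^k.
Proof. by rewrite /egf !poly_def big_ord_recr. Qed.
End Egf.

(** The distance to the fixed point [y / (1 - r)] shrinks by the factor [r] up to
    an error that tends to zero. *)
Lemma affine_recursion_cvg (R : realType) (r y : R) (x_ y_ : nat -> R) :
  0 <= r < 1 -> y_ n @[n --> \oo] --> y ->
  (forall n, x_ n.+1 = r * x_ n + y_ n) ->
  x_ n @[n --> \oo] --> y / (1 - r).
Proof.
move=> /andP[r0 r1] yy rec; set l := y / (1 - r).
have r1' : 0 < 1 - r by rewrite subr_gt0.
have ly : y = l - r * l by rewrite /l; field; rewrite gt_eqF.
apply/cvgrPdist_le => e e0.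
have e1 : 0 < e * (1 - r) / 2 by rewrite divr_gt0 // mulr_gt0.
move/cvgrPdist_le: yy => /(_ _ e1) [N _ yN].
have bound j : `|l - x_ (N + j)%N| <= r ^+ j * `|l - x_ N| + e / 2.
  elim: j => [|j IH]; first by rewrite addn0 expr0 mul1r lerDl; lra.
  rewrite addnS rec.
  have -> : l - (r * x_ (N + j)%N + y_ (N + j)%N) =
      r * (l - x_ (N + j)%N) + (y - y_ (N + j)%N) by rewrite ly; ring.
  apply: (le_trans (ler_normD _ _)); rewrite normrM (ger0_norm r0).
  have := yN (N + j)%N (leq_addr _ _) => /= yj.
  have := ler_wpM2l r0 IH => rIH.
  apply: (le_trans (lerD rIH yj)); rewrite exprS.
  by rewrite le_eqVlt; apply/orP; left; apply/eqP; field.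
have : r ^+ j * `|l - x_ N| @[j --> \oo] --> 0 * `|l - x_ N|.
  by apply: cvgM; [apply: cvg_expr; rewrite ger0_norm | exact: cvg_cst].
rewrite mul0r => /cvgrPdist_le /(_ (e / 2)) [|M _ MM]; first by rewrite divr_gt0.
exists (N + M)%N => // n /= NMn.
have Nn : (N <= n)%N := leq_trans (leq_addr _ _) NMn.
rewrite -(subnKC Nn); apply: (le_trans (bound _)).
have /= := MM (n - N)%N; rewrite leq_subRL // => /(_ NMn).
by rewrite sub0r normrN ger0_norm ?mulr_ge0 ?exprn_ge0 // => ?; lra.
Qed.

Section MomentLimit.
Variables (R : realType) (p : nat).
Hypothesis p_gt1 : (1 < p)%N.
Local Notation lam := (lambda R p).
Local Notation pr := (p%:R : R).

(** Up to [k`!], the part of the [k]-th moment of a sum of [p] independent copies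
    that involves only moments of order less than [k]. *)
Definition cross_moment k (u : nat -> R) : R :=
  \sum_(i : {ffun 'I_p -> 'I_k} | (\sum_(l < p) i l == k)%N)
    \prod_(l < p) (u (i l) / (i l)`!%:R).

(** In the [k]-th moment of a sum of [p] copies the [k]-th moment itself appears
    [p] times. With probability [1 / p] from the sum and [1 - 1 / p] from the
    single copy, its total coefficient is [1 + (1 - 1 / p) = lambda]. *)
Lemma gmean_exprS k n : (0 < k)%N ->
  gmean p n.+1 (fun x => x ^+ k) =
  lam ^- k * (lam * gmean p n (fun x => x ^+ k) +
    pr^-1 * k`!%:R * cross_moment k (fun i => gmean p n (fun x => x ^+ i))).
Proof.
move=> k0.
have sc f : mean (lam ^- n) (fun x => (lam^-1 * x) ^+ k) f =
    lam ^- k * moment (lam ^- n) f k.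
  by rewrite -mean_funZ; apply: eq_mean => x; rewrite exprMn exprVn.
rewrite gmeanS /gmean !sc -!/(moment _ _ _).
set c := lam ^- n; set f := generation R p n.
have fN0 j : j`!%:R != 0 :> R by rewrite pnatr_eq0 -lt0n fact_gt0.
have pN0 : pr != 0 by rewrite pnatr_eq0 -lt0n ltnW.
have c1 : moment c f 0 = 1 by exact: (gmean_cst p_gt1).
have : (egf k.+1 (moment c (f ^+ p)))`_k =
    cross_moment k (moment c f) + pr * (moment c f k / k`!%:R).
  rewrite coef_egfX // egfS coef_expD_Xn ?coef_egf_exp //.
  by rewrite coef_egf // c1 fact0 divr1.
rewrite coef_egf // => e.
have -> : moment c (f ^+ p) k =
    k`!%:R * (cross_moment k (moment c f) + pr * (moment c f k / k`!%:R)).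
  by rewrite -e mulrC divfK.
rewrite -[X in cross_moment k X]/(moment c f).
by set L := lam ^- k; rewrite /lambda; field; rewrite fN0 pN0.
Qed.

Variable m : nat -> R.
Hypotheses (m0 : m 0%N = 1) (m1 : m 1%N = 1).
Hypothesis m_rec : forall k, (2 <= k)%N ->
  m k = (pr - 1)^-1 * ((lam - 1) / (lam ^+ k - lam)) *
    \sum_(i : {ffun 'I_p -> 'I_k} | (\sum_(l < p) i l == k)%N)
      ((k`!)%:R / (\prod_(l < p) (i l)`!)%N%:R * \prod_(l < p) m (i l)).

Lemma moment_recE k : (2 <= k)%N ->
  m k = (pr^-1 * k`!%:R * cross_moment k m) / (lam ^+ k - lam).
Proof.
move=> k2; rewrite m_rec //.
have -> : \sum_(i : {ffun 'I_p -> 'I_k} | (\sum_(l < p) i l == k)%N)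
      ((k`!)%:R / (\prod_(l < p) (i l)`!)%N%:R * \prod_(l < p) m (i l)) =
    k`!%:R * cross_moment k m.
  rewrite /cross_moment mulr_sumr; apply: eq_bigr => i _.
  by rewrite big_split /= prodfV natr_prod -mulrA [_^-1 * _]mulrC.
have := p_gt1R R p_gt1; rewrite -subr_gt0 => pm1.
have lk : lam ^+ k - lam != 0.
  rewrite subr_eq0 gt_eqF // -{1}[lam]expr1 ltr_eXn2l //.
  exact: lambda_gt1.
rewrite {1}/lambda; field.
by rewrite lk (gt_eqF pm1) pnatr_eq0 -lt0n ltnW.
Qed.

(** For [2 <= k] the moments satisfy an affine recursion with ratio
    [lambda ^ (1 - k) < 1] and a constant term built from lower moments, which
    converge by induction. The recursion for [m] says that [m k] is the fixed
    point. *)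
Lemma gmean_expr_cvg k : gmean p n (fun x => x ^+ k) @[n --> \oo] --> m k.
Proof.
elim/ltn_ind: k => -[|[|k]] IH.
- rewrite m0 (_ : (fun n => _) = fun=> 1); first exact: cvg_cst.
  by apply/funext => n; rewrite -[RHS](gmean_cst p_gt1 n 1).
- rewrite m1 (_ : (fun n => _) = fun=> 1); first exact: cvg_cst.
  by apply/funext => n; rewrite -[RHS](gmean_id R p_gt1 n).
set K := k.+2.
have l0 : 0 < lam by exact: lambda_gt0.
have l1 : 1 < lam by exact: lambda_gt1.
have lK : lam < lam ^+ K by rewrite -{1}[lam]expr1 ltr_eXn2l.
pose y_ n := lam ^- K * (pr^-1 * K`!%:R *
  cross_moment K (fun i => gmean p n (fun x => x ^+ i))).
have yy : y_ n @[n --> \oo] --> lam ^- K * (pr^-1 * K`!%:R * cross_moment K m).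
  apply: cvgM; first exact: cvg_cst.
  apply: cvgM; first exact: cvg_cst.
  apply: (cvg_big add_continuous) => i _.
  apply: (cvg_big mul_continuous) => l _.
  by apply: cvgM; [exact: IH | exact: cvg_cst].
have r01 : 0 <= lam / lam ^+ K < 1.
  by rewrite divr_ge0 ?exprn_ge0 ?ltW //= ltr_pdivrMr ?exprn_gt0 // mul1r.
have := affine_recursion_cvg r01 yy.
have -> : lam ^- K * (pr^-1 * K`!%:R * cross_moment K m) / (1 - lam / lam ^+ K) = m K.
  rewrite moment_recE //; field.
  by rewrite subr_eq0 !gt_eqF ?exprn_gt0 // (lt_trans ltr01) // p_gt1R.
apply=> n; rewrite gmean_exprS // mulrDr; congr (_ + _).
by rewrite mulrA; congr (_ * _); rewrite mulrC.
Qed.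

End MomentLimit.

(** * No mass near zero *)

(** A sum of nonnegative variables is at most [y] only if all of them are. *)
Lemma mean_exp_tail_le (R : realFieldType) (c y : R) (f : {poly R}) q :
  0 <= c -> 0 <= y -> is_pgf f ->
  mean c (fun x => (x <= y)%R%:R) (f ^+ q) <= mean c (fun x => (x <= y)%R%:R) f ^+ q.
Proof.
move=> c0 y0 hf; elim: q => [|q IH].
  by rewrite !expr0 -(expr0 'X) meanXn mulr0 y0.
set T := mean _ _ f.
have T0 : 0 <= T by apply: mean_ge0.
rewrite !exprSr -(expr1 f) meanM expr1.
set g := f ^+ q in IH *.
have hg : is_pgf g by exact: is_pgfX.
apply: (@le_trans _ _ (mean c (fun x =>
    mean c (fun z => (x <= y)%R%:R * (z <= y)%R%:R) f) g)).
  apply: ler_mean => // x x0; apply: ler_mean => // z z0.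
  have [xzy|_] := leP (x + z) y; last by rewrite mulr_ge0.
  by rewrite !(le_trans _ xzy) ?lerDl ?lerDr // mulr1.
under eq_mean => x do rewrite mean_funZ mulrC.
by rewrite mean_funZ mulrC; apply: ler_wpM2r.
Qed.

Section LeftTail.
Variables (R : realType) (p : nat).
Hypothesis p_gt1 : (1 < p)%N.
Local Notation lam := (lambda R p).
Local Notation pr := (p%:R : R).

Definition lower_tail n (e : R) : R := gmean p n (fun x => (x <= e)%R%:R).

Lemma lower_tail_ge0 n e : 0 <= lower_tail n e.
Proof.
apply: mean_ge0 => //; [exact: scale_ge0|exact: is_pgf_generation].
Qed.

Lemma lower_tail0 e : e < 1 -> lower_tail 0 e = 0.
Proof.
by move=> e1; rewrite /lower_tail /gmean /= -(expr1 'X) meanXn expr0 invr1 mul1r leNgt e1.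
Qed.

Lemma lower_tailS n e : 0 <= e -> lower_tail n.+1 e <=
  pr^-1 * lower_tail n (lam * e) ^+ p + (1 - pr^-1) * lower_tail n (lam * e).
Proof.
move=> e0; rewrite /lower_tail gmeanS.
have l0 : 0 < lam by exact: lambda_gt0.
have E : (fun x : R => (lam^-1 * x <= e)%R%:R : R) = (fun x => (x <= lam * e)%R%:R).
  by apply/funext => x; rewrite ler_pdivrMl.
rewrite E lerD2r ler_pM2l; last by have /andP[] := invp_itv R p_gt1.
apply: mean_exp_tail_le; [exact: scale_ge0| |exact: is_pgf_generation].
by rewrite mulr_ge0 // ltW.
Qed.

Variable M : R.
Hypothesis M_gt0 : 0 < M.
Hypothesis second_moment_le : forall n, gmean p n (fun x => x ^+ 2) <= M.

(** By Paley and Zygmund, a mean equal to one and a bounded second moment leave a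
    fixed amount of mass above [1 / 2]. *)
Lemma lower_tail_half n : lower_tail n (1 / 2) <= 1 - (4 * M)^-1.
Proof.
pose s := (4 * M)^-1.
have s0 : 0 < s by rewrite invr_gt0 mulr_gt0.
have sM : s * M = 1 / 4 by rewrite /s; field; rewrite gt_eqF.
have [b bE] : exists b, b = 1 / 2 + M by exists (1 / 2 + M).
(* Where x > 1 / 2, the bound is x <= s * x^2 + 1 / (4 * s) with M = 1 / (4 * s). *)
have : gmean p n id <= gmean p n (fun x => b +
    (s * x ^+ 2 + - M * (x <= 1 / 2)%R%:R)).
  apply: ler_mean => [||x x0]; [exact: scale_ge0|exact: is_pgf_generation|].
  have sx : 0 <= s * x ^+ 2 by rewrite mulr_ge0 ?sqr_ge0 // ltW.
  have [x2|_] := leP x (1 / 2); first by rewrite mulr1 bE; lra.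
  have : 0 <= s * (x - 2 * M) ^+ 2 by rewrite mulr_ge0 ?sqr_ge0 // ltW.
  have -> : s * (x - 2 * M) ^+ 2 = s * x ^+ 2 - 4 * (s * M) * x + 4 * (s * M) * M.
    by ring.
  by rewrite sM mulr0 bE; lra.
rewrite gmean_id // /gmean !mean_funD !mean_funZ.
rewrite -/(gmean p n (fun=> b)) gmean_cst //.
rewrite -[mean _ (fun x => (x <= 1 / 2)%R%:R) _]/(lower_tail n (1 / 2)).
rewrite -/(gmean p n (fun x => x ^+ 2)).
have := second_moment_le n; rewrite -(ler_pM2l s0) sM => h1 h2.
have h3 : M * lower_tail n (1 / 2) <= M - 1 / 4 by lra.
rewrite -(ler_pM2l M_gt0) mulrBr mulr1 [M * _^-1]mulrC sM.
exact: h3.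
Qed.

(** Below [t < 1] the map [x |-> x ^ p / p + (1 - 1 / p) * x] is a contraction
    towards [0], because [x ^ p <= t * x]. By [lower_tailS] the mass below
    [lambda ^ (- j) / 2] therefore decays geometrically in [j], uniformly in the
    generation. *)
Lemma lower_tail_small e : 0 < e ->
  exists2 d, 0 < d & forall n, lower_tail n d <= e.
Proof.
move=> e0.
pose t := 1 - (4 * M)^-1; pose rho := 1 - pr^-1 * (1 - t).
have t1 : t < 1 by rewrite /t ltrBlDr ltrDl invr_gt0 mulr_gt0.
have t0 : 0 <= t by apply: le_trans (lower_tail_half 0); exact: lower_tail_ge0.
have /andP[ip0 ip1] := invp_itv R p_gt1.
have rho1 : rho < 1 by rewrite /rho ltrBlDr ltrDl mulr_gt0 // subr_gt0.
have rho0 : 0 <= rho.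
  have := mulr_ge0 (ltW ip0) t0; rewrite /rho; lra.
have l1 : 1 < lam by exact: lambda_gt1.
have l0 : 0 < lam by exact: lambda_gt0.
have bound j n : lower_tail n (lam ^- j / 2) <= rho ^+ j * t.
  elim: j n => [|j IH] n.
    by rewrite !expr0 invr1 [leRHS]mul1r; exact: lower_tail_half.
  have lj : lam ^- j.+1 <= 1 by rewrite invf_le1 ?exprn_gt0 // exprn_ege1 // ltW.
  case: n => [|n].
    rewrite lower_tail0; last by lra.
    by rewrite mulr_ge0 // exprn_ge0.
  apply: (le_trans (lower_tailS _ _)).
    by rewrite divr_ge0 // invr_ge0 exprn_ge0 // ltW.
  have -> : lam * (lam ^- j.+1 / 2) = lam ^- j / 2.
    by rewrite exprS; field; rewrite !gt_eqF ?exprn_gt0.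
  set x := lower_tail n _.
  have x0 : 0 <= x by exact: lower_tail_ge0.
  have xt : x <= t.
    apply: (le_trans (IH n)); rewrite -[leRHS]mul1r ler_wpM2r //.
    by rewrite exprn_ile1 // ltW.
  have xp : x ^+ p <= t * x.
    rewrite -(subnKC p_gt1) exprD expr2 -mulrA -mulrCA.
    rewrite [leRHS]mulrC ler_wpM2l // -[leRHS]mulr1 ler_pM ?exprn_ge0 //.
    by rewrite exprn_ile1 // (le_trans xt) // ltW.
  have := IH n; rewrite -/x => xI.
  apply: (@le_trans _ _ (rho * x)).
    have := ler_wpM2l (ltW ip0) xp; rewrite /rho; lra.
  by rewrite exprS -mulrA ler_wpM2l.
have : rho ^+ j * t @[j --> \oo] --> 0 * t.
  by apply: cvgM; [apply: cvg_expr; rewrite ger0_norm | exact: cvg_cst].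
rewrite mul0r => /cvgrPdist_le /(_ e e0) [N _ /(_ N (leqnn N))] /=.
rewrite sub0r normrN ger0_norm ?mulr_ge0 ?exprn_ge0 // => rN.
exists (lam ^- N / 2) => [|n]; last exact: le_trans (bound N n) rN.
by rewrite divr_gt0 // invr_gt0 exprn_gt0.
Qed.

End LeftTail.

(** * Limits of tails from limits of convex functions *)

(** What is needed of [g_ n x = E (W_n - x)^+] and [G_ n x = P (W_n > x)] for a
    sequence of nonnegative variables of mean one that increases in the convex
    order. The first field says that [- G_ n] is between the slopes of [g_ n] on
    both sides of a point. *)
Record excess_sequence (R : realType) (g_ G_ : nat -> R -> R) : Prop := {
  excess_seq_slope : forall n x y, x <= y ->
    (y - x) * G_ n y <= g_ n x - g_ n y <= (y - x) * G_ n x;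
  excess_seq_itv : forall n x, 0 <= G_ n x <= 1;
  excess_seq_nd : forall n x, g_ n x <= g_ n.+1 x;
  excess_seq_ge0 : forall n x, 0 <= g_ n x;
  excess_seq_le0 : forall n x, x <= 0 -> g_ n x = 1 - x
}.

Section LimitTail.
Variables (R : realType) (g_ G_ : nat -> R -> R).
Hypothesis gG : excess_sequence g_ G_.

Let g_slope := excess_seq_slope gG.
Let G_itv := excess_seq_itv gG.
Let g_nondecreasing := excess_seq_nd gG.
Let g_ge0 := excess_seq_ge0 gG.
Let g_le0E := excess_seq_le0 gG.

Definition limit_excess (x : R) : R := limn (g_ ^~ x).
Local Notation g := limit_excess.

Lemma limit_excess_cvg x : g_ n x @[n --> \oo] --> g x.
Proof.
apply: nondecreasing_is_cvgn; first exact/nondecreasing_seqP.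
exists (g_ 0%N (Num.min x 0)) => _ [n _ <-].
rewrite (g_le0E 0%N) ?ge_min ?lexx ?orbT // -(g_le0E n) ?ge_min ?lexx ?orbT //.
have mx : Num.min x 0 <= x by rewrite ge_min lexx.
have /andP[+ _] := g_slope n mx; have /andP[G0 _] := G_itv n x.
by move/(le_trans (mulr_ge0 _ G0)); rewrite !subr_ge0; exact.
Qed.

Lemma limit_excess_le0 x : x <= 0 -> g x = 1 - x.
Proof.
move=> x0; apply: cvg_lim => //.
by under eq_fun do rewrite g_le0E //; exact: cvg_cst.
Qed.

Lemma limit_excess_ge0 x : 0 <= g x.
Proof.
by apply: (cvgr_to_ge (@limit_excess_cvg x)); exact: nearW.
Qed.

Lemma limit_excess_diff_cvg x y :
  g_ n x - g_ n y @[n --> \oo] --> g x - g y.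
Proof. by apply: cvgB; exact: limit_excess_cvg. Qed.

Lemma limit_excess_lipschitz x y : x <= y -> g x - g y <= y - x.
Proof.
move=> xy; apply: (cvgr_to_le (@limit_excess_diff_cvg x y)).
apply: nearW => n; have /andP[_ h] := g_slope n xy; apply: (le_trans h).
by have /andP[_ G1] := G_itv n x; rewrite ler_piMr // subr_ge0.
Qed.

Lemma limit_excess_nonincreasing x y : x <= y -> 0 <= g x - g y.
Proof.
move=> xy; apply: (cvgr_to_ge (@limit_excess_diff_cvg x y)).
apply: nearW => n; have /andP[h _] := g_slope n xy; apply: le_trans h.
by have /andP[G0 _] := G_itv n y; rewrite mulr_ge0 // subr_ge0.
Qed.

(** The limit is convex because [- G_ n] separates consecutive slopes of
    [g_ n]. *)
Lemma limit_excess_chord x y z : x < y -> y < z ->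
  (g y - g z) / (z - y) <= (g x - g y) / (y - x).
Proof.
move=> xy yz; have [xy' yz'] : 0 < y - x /\ 0 < z - y by rewrite !subr_gt0.
apply: (@ler_cvg_to nat \oo _ R (fun n => (g_ n y - g_ n z) / (z - y))
    (fun n => (g_ n x - g_ n y) / (y - x))).
- by apply: cvgM; [exact: limit_excess_diff_cvg|exact: cvg_cst].
- by apply: cvgM; [exact: limit_excess_diff_cvg|exact: cvg_cst].
apply: nearW => n.
have /andP[h1 _] := g_slope n (ltW xy); have /andP[_ h2] := g_slope n (ltW yz).
apply: (@le_trans _ _ (G_ n y)).
  by rewrite ler_pdivrMr // mulrC.
by rewrite ler_pdivlMr // mulrC.
Qed.

(** Minus the right derivative of the convex function [limit_excess]. *)
Definition limit_tail (x : R) : R :=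
  sup [set (g x - g (x + h)) / h | h in [set h | 0 < h]].
Local Notation G := limit_tail.

Lemma limit_tail_has_sup x :
  has_sup [set (g x - g (x + h)) / h | h in [set h | 0 < h]].
Proof.
split; first by exists ((g x - g (x + 1)) / 1); exists 1 => //=; exact: ltr01.
exists 1 => _ [h h0 <-]; rewrite ler_pdivrMr // mul1r.
apply: (le_trans (limit_excess_lipschitz _)); first by rewrite lerDl ltW.
by rewrite addrAC subrr add0r.
Qed.

Lemma slope_le_limit_tail x y : x < y -> (g x - g y) / (y - x) <= G x.
Proof.
move=> xy; apply: ub_le_sup; first by case: (limit_tail_has_sup x).
by exists (y - x); rewrite /= ?subr_gt0 // (addrC x) subrK.
Qed.

Lemma limit_tail_le x b :
  (forall y, x < y -> (g x - g y) / (y - x) <= b) -> G x <= b.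
Proof.
move=> H; apply: ge_sup; first by case: (limit_tail_has_sup x).
move=> _ [h /= h0 <-]; have := H (x + h).
by rewrite ltrDl => /(_ h0); rewrite addrAC subrr add0r.
Qed.

Lemma limit_tail_le_slope x y : x < y -> G y <= (g x - g y) / (y - x).
Proof. by move=> xy; apply: limit_tail_le => z; exact: limit_excess_chord. Qed.

Lemma limit_tail_nonincreasing x y : x <= y -> G y <= G x.
Proof.
rewrite le_eqVlt => /predU1P[->//|xy].
exact: le_trans (limit_tail_le_slope xy) (slope_le_limit_tail xy).
Qed.

Lemma limit_tail_ge0 x : 0 <= G x.
Proof.
have x1 : x < x + 1 by rewrite ltrDl.
apply: le_trans (slope_le_limit_tail x1).
by rewrite divr_ge0 ?limit_excess_nonincreasing ?subr_ge0 // ltW.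
Qed.

Lemma limit_tail_le1 x : G x <= 1.
Proof.
apply: limit_tail_le => y xy; rewrite ler_pdivrMr ?subr_gt0 // mul1r.
exact/limit_excess_lipschitz/ltW.
Qed.

Lemma limit_tail_approx x e : 0 < e ->
  exists2 y, x < y & G x - e < (g x - g y) / (y - x).
Proof.
move=> e0; have [_ [h /= h0 <-] he] := sup_adherent e0 (limit_tail_has_sup x).
by exists (x + h); rewrite ?ltrDl // addrAC subrr add0r.
Qed.

(** A supremum of continuous functions is lower semicontinuous; as the tail is
    nonincreasing, this is continuity from the right. *)
Lemma limit_tail_right x e : 0 < e ->
  exists2 y, x < y & forall z, x <= z -> z <= y -> G x - e <= G z.
Proof.
move=> e0; have e2 : 0 < e / 2 by rewrite divr_gt0.
have [y xy hy] := limit_tail_approx x e2.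
have yx0 : 0 < y - x by rewrite subr_gt0.
(* Half of e is lost in the choice of y, the other half in moving x to z. *)
pose d := Num.min ((y - x) / 2) (e / 2 * (y - x)).
have d0 : 0 < d by rewrite lt_min divr_gt0 // mulr_gt0.
exists (x + d); rewrite ?ltrDl // => z xz zd.
have zy : z < y.
  apply: (le_lt_trans zd); have : d <= (y - x) / 2 by rewrite ge_min lexx.
  lra.
have zx : z - x <= e / 2 * (y - x).
  by rewrite lerBlDl (le_trans zd) // lerD2l ge_min lexx orbT.
apply: le_trans (slope_le_limit_tail zy).
apply: (@le_trans _ _ ((g z - g y) / (y - x))); last first.
  rewrite ler_wpM2l ?limit_excess_nonincreasing ?(ltW zy) //.
  by rewrite lef_pV2 ?posrE ?subr_gt0 // lerD2l lerN2.
have := limit_excess_lipschitz xz.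
move: hy; rewrite ltr_pdivlMr // => hy gxz.
by rewrite ler_pdivlMr //; lra.
Qed.

Lemma limit_tail_lt0 x : x < 0 -> G x = 1.
Proof.
move=> x0; apply/eqP; rewrite eq_le limit_tail_le1 /=.
apply: le_trans (slope_le_limit_tail x0).
rewrite !limit_excess_le0 ?(ltW x0) // ler_pdivlMr ?mul1r; last by lra.
by lra.
Qed.

(** Markov's inequality in the limit. *)
Lemma limit_tail_le_inv x : 0 < x -> G x <= x^-1.
Proof.
move=> x0; apply: (le_trans (limit_tail_le_slope x0)).
rewrite subr0 limit_excess_le0 // subr0 ler_pdivrMr // mulVf ?gt_eqF //.
by rewrite gerBl limit_excess_ge0.
Qed.

(** Tails converge because they are squeezed between slopes of the excess
    functions on the left and on the right of [x]. These slopes converge, and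
    their limits are close to [limit_tail x] when it is left continuous
    there. *)
Lemma limit_tail_cvg x :
  (forall e, 0 < e -> exists2 y, y < x & G y <= G x + e) ->
  G_ n x @[n --> \oo] --> G x.
Proof.
move=> left_cont; apply/cvgrPdist_lt => e e0.
have e2 : 0 < e / 2 by rewrite divr_gt0.
have [y yx Gy] := left_cont _ e2.
have [z xz Gz] := limit_tail_approx x e2.
have yx0 : 0 < x - y by rewrite subr_gt0.
have xz0 : 0 < z - x by rewrite subr_gt0.
have Hy : (g y - g x) / (x - y) < G x + e.
  by apply: (le_lt_trans (slope_le_limit_tail yx)); lra.
have Hz : G x - e < (g x - g z) / (z - x) by lra.
have Cy : (g_ n y - g_ n x) / (x - y) @[n --> \oo] --> (g y - g x) / (x - y).
  by apply: cvgM; [exact: limit_excess_diff_cvg|exact: cvg_cst].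
have Cz : (g_ n x - g_ n z) / (z - x) @[n --> \oo] --> (g x - g z) / (z - x).
  by apply: cvgM; [exact: limit_excess_diff_cvg|exact: cvg_cst].
near=> n.
have h1 : (g_ n y - g_ n x) / (x - y) < G x + e.
  by near: n; exact: cvgr_lt Cy _ Hy.
have h2 : G x - e < (g_ n x - g_ n z) / (z - x).
  by near: n; exact: cvgr_gt Cz _ Hz.
have /andP[h3 _] := g_slope n (ltW yx); have /andP[_ h4] := g_slope n (ltW xz).
rewrite ltr_norml; apply/andP; split.
  rewrite ltrBrDl -ltrBrDr opprK; apply: le_lt_trans h1.
  by rewrite ler_pdivlMr // mulrC.
rewrite ltrBlDr -ltrBlDl; apply: (lt_le_trans h2).
by rewrite ler_pdivrMr // mulrC.
Unshelve. all: by end_near. Qed.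

End LimitTail.

(** * The limit law *)

Lemma probability_of_cdf (R : realType) (F : R -> R) :
    {homo F : x y / x <= y} -> right_continuous F ->
    F @ -oo --> (0 : R) -> F @ +oo --> (1 : R) ->
  exists P : probability (measurableTypeR R) R,
    forall x, P `]-oo, x]%classic = (F x)%:E.
Proof.
move=> Fnd Frc F0 F1.
pose C := HB.pack_for (cumulativeBounded (0 : R) (1 : R)) F
  (isCumulative.Build R _ R F Fnd Frc)
  (isCumulativeBounded.Build R 0 1 F F0 F1).
exists (lebesgue_stieltjes_measure C : probability _ _) => x.
exact: (cdf_lebesgue_stieltjes_id C x).
Qed.

Section GenerationTail.
Variables (R : realType) (p : nat).
Hypothesis p_gt1 : (1 < p)%N.
Local Notation lam := (lambda R p).

Definition excess n (x : R) : R := gmean p n (fun w => Num.max (w - x) 0).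
Definition upper_tail n (x : R) : R := gmean p n (fun w => (x < w)%R%:R).

Lemma excess_slope n x y : x <= y ->
  (y - x) * upper_tail n y <= excess n x - excess n y <= (y - x) * upper_tail n x.
Proof.
move=> xy; have c0 := scale_ge0 R p_gt1 n; have f0 := is_pgf_generation R p_gt1 n.
rewrite /upper_tail /excess /gmean -!mean_funZ -[- mean _ _ _]mulN1r.
rewrite -mean_funZ -mean_funD.
apply/andP; split; apply: ler_mean => // w _; rewrite mulN1r.
  have [yw|yw] := ltP y w; rewrite ?mulr1 ?mulr0;
    by case: (leP (w - x) 0); case: (leP (w - y) 0); lra.
have [xw|xw] := ltP x w; rewrite ?mulr1 ?mulr0;
  by case: (leP (w - x) 0); case: (leP (w - y) 0); lra.
Qed.

Lemma upper_tail_itv n x : 0 <= upper_tail n x <= 1.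
Proof.
have c0 := scale_ge0 R p_gt1 n; have f0 := is_pgf_generation R p_gt1 n.
apply/andP; split; first by apply: mean_ge0.
rewrite -(gmean_cst p_gt1 n 1); apply: ler_mean => // w _.
by rewrite lern1 leq_b1.
Qed.

Lemma upper_tailE n x : upper_tail n x = 1 - lower_tail p n x.
Proof.
suff <- : upper_tail n x + lower_tail p n x = 1 by rewrite addrK.
rewrite /upper_tail /lower_tail /gmean -mean_funD -[RHS](gmean_cst p_gt1 n 1).
by apply: eq_mean => w; case: ltP; rewrite ?addr0 ?add0r.
Qed.

Lemma excess_nondecreasing n x : excess n x <= excess n.+1 x.
Proof. exact: gmean_excess_nondecreasing. Qed.

Lemma excess_ge0 n x : 0 <= excess n x.
Proof.
have c0 := scale_ge0 R p_gt1 n; have f0 := is_pgf_generation R p_gt1 n.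
by apply: mean_ge0 => // w _; rewrite le_max lexx orbT.
Qed.

Lemma excess_le0 n x : x <= 0 -> excess n x = 1 - x.
Proof.
have c0 := scale_ge0 R p_gt1 n; have f0 := is_pgf_generation R p_gt1 n.
move=> x0; transitivity (gmean p n (fun w => w + - x)).
  by apply/eqP; rewrite eq_le; apply/andP; split; apply: ler_mean => // w w0;
    case: (leP (w - x) 0) => //; lra.
rewrite /gmean mean_funD -/(gmean p n id) -/(gmean p n (fun=> - x)).
by rewrite gmean_id // gmean_cst.
Qed.

Lemma generation_excess_sequence : excess_sequence excess upper_tail.
Proof.
by split; [exact: excess_slope|exact: upper_tail_itv|
  exact: excess_nondecreasing|exact: excess_ge0|exact: excess_le0].
Qed.

Definition tail (x : R) : R := limit_tail excess x.

Lemma lower_tail_cvg x :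
  (forall e, 0 < e -> exists2 y, y < x & tail y <= tail x + e) ->
  lower_tail p n x @[n --> \oo] --> 1 - tail x.
Proof.
move=> H; have -> : lower_tail p ^~ x = (fun n => 1 - upper_tail n x).
  by apply/funext => n; rewrite upper_tailE subKr.
by apply: cvgB; [exact: cvg_cst | exact: (limit_tail_cvg generation_excess_sequence)].
Qed.

(** [E (W_n)^+ - E (W_n - d)^+ >= d * P (W_n > d)], so that the slope of the
    limit on the interval from [0] to [d] is at least [1 - e] as soon as the
    lower tails at [d] are at most [e]. *)
Lemma tail0 (M : R) : 0 < M -> (forall n, gmean p n (fun x => x ^+ 2) <= M) ->
  tail 0 = 1.
Proof.
move=> M0 MM; have ub := @limit_tail_le1 R excess upper_tail generation_excess_sequence.
apply/eqP; rewrite eq_le ub /=; apply/ler_addgt0Pl => e e0.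
have [d d0 dM] := lower_tail_small p_gt1 M0 MM e0.
have slope := @slope_le_limit_tail R excess upper_tail generation_excess_sequence.
have := slope 0 d d0; rewrite subr0 => h.
rewrite -lerBlDl; apply: le_trans h; rewrite ler_pdivlMr // mulrC.
have C := @limit_excess_diff_cvg R excess upper_tail generation_excess_sequence 0 d.
apply: (cvgr_to_ge C); apply: nearW => n.
have /andP[+ _] := excess_slope n (ltW d0); apply: le_trans.
by rewrite subr0 ler_wpM2l ?(ltW d0) // upper_tailE lerD2l lerN2.
Qed.

Lemma tail_right_continuous : right_continuous (fun x => 1 - tail x).
Proof.
move=> x; apply/cvgrPdist_le => e e0.
have [y xy H] := @limit_tail_right R excess upper_tail generation_excess_sequence x e e0.
near=> z.
have xz : x <= z by near: z; exact: nbhs_right_ge.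
have zy : z <= y by near: z; exact: nbhs_right_le.
have -> : 1 - tail x - (1 - tail z) = - (tail x - tail z) by ring.
rewrite normrN ger0_norm; first by rewrite lerBlDr -lerBlDl; exact: H.
by rewrite subr_ge0; exact: (limit_tail_nonincreasing generation_excess_sequence).
Unshelve. all: by end_near. Qed.

Lemma limit_law : exists P : probability (measurableTypeR R) R,
  forall x, P `]-oo, x]%classic = (1 - tail x)%:E.
Proof.
apply: probability_of_cdf.
- move=> x y xy; rewrite lerD2l lerN2.
  exact: (@limit_tail_nonincreasing R excess upper_tail generation_excess_sequence).
- exact: tail_right_continuous.
- apply: cvg_near_cst; exists 0; split => // x x0.
  rewrite /tail (@limit_tail_lt0 R excess upper_tail generation_excess_sequence) ?subrr //.
apply/cvgrPdist_le => e e0; near=> x.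
have x0 : 0 < x by near: x; exact: nbhs_pinfty_gt.
rewrite subKr ger0_norm; last first.
  exact: (@limit_tail_ge0 R excess upper_tail generation_excess_sequence).
apply: le_trans (@limit_tail_le_inv R excess upper_tail generation_excess_sequence x x0) _.
rewrite invf_ple ?posrE //; near: x; exact: nbhs_pinfty_ge.
Unshelve. all: by end_near. Qed.
End GenerationTail.

(** * Moments of the limit law *)

(** A right continuous nondecreasing function is left continuous except at its
    jumps. *)
Lemma countable_left_jumps (R : realType) (F : R -> R) :
    {homo F : x y / x <= y} -> right_continuous F ->
  countable [set x | ~ (F y @[y --> x^'-] --> F x)].
Proof.
move=> Fnd Frc.
pose D (n : nat) : set R := [set x | x \in (`]- n%:R, n%:R[) /\ discontinuity F x].
apply: (@sub_countable _ _ _ (\bigcup_n D n)); last first.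
  apply: bigcup_countable => // n _; apply: discontinuity_countable.
  by move=> x y _ _; exact: Fnd.
apply: subset_card_le => x Fx.
exists (Num.truncn `|x|).+1 => //; split.
  by rewrite in_itv /= -ltr_norml truncnS_gt.
have Cl : cvg (F y @[y --> x^'-]).
  apply: nondecreasing_at_left_is_cvgr.
    by apply: nearW => y z t _ _; exact: Fnd.
  near=> y; exists (F x) => _ [z /= + <-].
  by rewrite in_itv /= => /andP[_ /ltW]; exact: Fnd.
have Cr := Frc x.
split=> //; first by apply/cvg_ex; exists (F x).
apply/negP => /eqP e; apply: Fx.
by move: Cl; rewrite e (cvg_lim _ Cr).
Unshelve. all: by end_near. Qed.

Section GenerationMoment.
Variables (R : realType) (p : nat).
Hypothesis p_gt1 : (1 < p)%N.
Local Notation lam := (lambda R p).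
Local Notation mu := (@lebesgue_measure R).
Local Notation tail := (@tail R p).

Definition power_tail n k (r : R) : R := gmean p n (fun x => (r < x ^+ k)%R%:R).

(** The tail formula for the expectation of a finite distribution. *)
Lemma integral_power_tail n k :
  (\int[mu]_(r in `[0%R, +oo[) (power_tail n k r)%:E)%E =
  (gmean p n (fun x => x ^+ k))%:E.
Proof.
have f0 : forall i, 0 <= (generation R p n)`_i := (is_pgf_generation R p_gt1 n).1.
have c0 := scale_ge0 R p_gt1 n.
pose a i : R := (lam ^- n * i%:R) ^+ k.
have a0 i : 0 <= a i by rewrite exprn_ge0 // mulr_ge0.
pose f (i : 'I_(size (generation R p n))) (r : R) :=
  (((generation R p n)`_i)%:E * (\1_(`]-oo, a i[%classic) r)%:E)%E.
have mf i : measurable_fun (`[0%R, +oo[ : set R) (f i).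
  by apply: measurable_funeM; apply/measurable_EFinP; exact: measurable_indic.
transitivity (\int[mu]_(r in `[0%R, +oo[) \sum_i f i r)%E.
  apply: eq_integral => r _; rewrite sumEFin; congr (_%:E).
  by apply: eq_bigr => i _; rewrite indicE mem_setE in_itv.
rewrite ge0_integral_sum //; last first.
  by move=> i r _; rewrite /f -EFinM lee_fin mulr_ge0.
rewrite /gmean /mean -sumEFin; apply: eq_bigr => i _.
rewrite ge0_integralZl_EFin //; [|by apply/measurable_EFinP; exact: measurable_indic].
rewrite EFinM; congr (_ * _)%E.
rewrite integral_indic // setIC -(set_itv_splitI `[0%R, (a i)[).
apply: eq_trans (lebesgue_measure_itv `[0%R, a i[) _; rewrite /= lte_fin.
rewrite -/(a i); have [ai|ai] := ltP 0 (a i); first by rewrite sube0.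
by rewrite (_ : a i = 0) //; apply/le_anti; rewrite ai a0.
Qed.

Lemma measurable_power_tail n k : measurable_fun setT (power_tail n k).
Proof.
apply: measurable_sum => i; apply: measurable_funM => //.
set y := (_ ^+ k).
have -> : (fun r : R => (r < y)%R%:R) = \1_(`]-oo, y[%classic) :> (R -> R).
  by apply/funext => r; rewrite indicE mem_setE in_itv.
exact: measurable_indic.
Qed.

(** Markov's inequality for [1 + W ^ (2 k)], which gives a bound integrable in
    [r]. *)
Lemma power_tail_le n k r (M : R) : 0 <= r ->
  gmean p n (fun x => x ^+ (k * 2)) <= M ->
  0 <= power_tail n k r <= (1 + M) * (oneDsqr r)^-1.
Proof.
move=> r_ge0 HM.
have c0 := scale_ge0 R p_gt1 n; have f0 := is_pgf_generation R p_gt1 n.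
apply/andP; split; first by apply: mean_ge0.
have r0 : 0 < oneDsqr r by rewrite (lt_le_trans ltr01) // oneDsqr_ge1.
have rM : (oneDsqr r)^-1 * gmean p n (fun x => x ^+ (k * 2)) <= (oneDsqr r)^-1 * M.
  by rewrite ler_pM2l // invr_gt0.
have : power_tail n k r <=
    gmean p n (fun x => (oneDsqr r)^-1 * 1 + (oneDsqr r)^-1 * x ^+ (k * 2)).
  apply: ler_mean => // x x0; rewrite -mulrDr mulrC ler_pdivlMr //.
  have xk : 0 <= x ^+ k * x ^+ k by rewrite mulr_ge0 // exprn_ge0.
  rewrite muln2 -addnn exprD; case: ltP => [rx|_]; last by rewrite mul0r; lra.
  by rewrite mul1r lerD2l expr2 ler_pM // ltW.
rewrite /gmean mean_funD mean_funZ -/(gmean p n (fun=> 1)) gmean_cst // mean_funZ.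
by move=> h; apply: (le_trans h); rewrite [leRHS]mulrC mulrDr lerD2l.
Qed.

Definition nat_root k (r : R) : R := r `^ (k%:R^-1).

Lemma nat_rootK k r : (0 < k)%N -> 0 <= r -> nat_root k r ^+ k = r.
Proof.
move=> k0 r0; rewrite -powR_mulrn ?powR_ge0 // -powRrM mulVf ?powRr1 //.
by rewrite pnatr_eq0 -lt0n.
Qed.

Lemma ltr_nat_root k r x : (0 < k)%N -> 0 <= r -> 0 <= x ->
  (r < x ^+ k) = (nat_root k r < x).
Proof.
move=> k0 r0 x0; rewrite -{1}(nat_rootK k0 r0) ltr_pXn2r //.
by rewrite nnegrE powR_ge0.
Qed.

Lemma power_tailE n k r : (0 < k)%N -> 0 <= r ->
  power_tail n k r = upper_tail p n (nat_root k r).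
Proof.
move=> k0 r0.
have c0 := scale_ge0 R p_gt1 n; have f0 := is_pgf_generation R p_gt1 n.
by apply/le_anti/andP; split; apply: ler_mean => // x x0; rewrite ltr_nat_root.
Qed.

Variable P : probability (measurableTypeR R) R.
Hypothesis P_cdf : forall x, P `]-oo, x]%classic = (1 - tail x)%:E.

(** The limit law has no mass on the negative numbers; cutting them off makes
    the random variable nonnegative everywhere, as the tail formula for
    expectations requires. *)
Definition pos_part (x : measurableTypeR R) : R := Num.max x 0.

Lemma measurable_pos_part : measurable_fun setT pos_part.
Proof. by apply: measurable_maxr => //; exact: measurable_id. Qed.

HB.instance Definition _ :=
  isMeasurableFun.Build _ _ _ _ pos_part measurable_pos_part.

Lemma tail_lt0 x : x < 0 -> tail x = 1.
Proof. exact: (limit_tail_lt0 (generation_excess_sequence R p_gt1)). Qed.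

Lemma cdf_pos_part x : cdf (pos_part : {RV P >-> R}) x = (1 - tail x)%:E.
Proof.
rewrite /cdf /distribution /pushforward /=.
have [x0|x0] := leP 0 x.
  rewrite -P_cdf; congr (P _); apply/seteqP; split=> w /=;
    by rewrite !in_itv /= /pos_part ge_max x0 andbT.
rewrite tail_lt0 // subrr; transitivity (P set0); last exact: measure0.
congr (P _); apply/seteqP; split=> w //=.
by rewrite in_itv /= /pos_part ge_max => /andP[_]; rewrite leNgt x0.
Qed.

(** The tails converge at the continuity points of the limit, and the [k]-th
    powers of the others form a countable set. *)
Lemma ae_power_tail_cvg k : (0 < k)%N ->
  {ae mu, forall r, (`[0%R, +oo[%classic : set R) r ->
    (power_tail n k r)%:E @[n --> \oo] --> (tail (nat_root k r))%:E}.
Proof.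
move=> k0; pose F x := 1 - tail x.
have Fnd : {homo F : x y / x <= y}.
  move=> x y xy; rewrite lerD2l lerN2.
  exact: (limit_tail_nonincreasing (generation_excess_sequence R p_gt1)).
have Frc : right_continuous F by exact: tail_right_continuous.
pose J := [set x | ~ (F y @[y --> x^'-] --> F x)].
have cJ : countable ((fun x => x ^+ k) @` J).
  exact/(sub_countable (card_image_le _ _))/countable_left_jumps.
exists ((fun x => x ^+ k) @` J); split.
- by apply: countable_measurable => // t; exact: measurable_set1.
- exact: countable_lebesgue_measure0.
move=> r /= H; exists (nat_root k r); last first.
  apply: nat_rootK => //; apply: contrapT => r0; apply: H.
  by rewrite in_itv /= andbT => /r0.
move=> Fr; apply: H; rewrite in_itv /= andbT => r0.
apply/cvg_EFin; first exact: nearW.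
under eq_fun do rewrite /= power_tailE //.
apply: (limit_tail_cvg (generation_excess_sequence R p_gt1)) => e e0.
move/cvgrPdist_le : Fr => /(_ e e0) Fr.
near (nat_root k r)^'- => y.
exists y; first by near: y; exact: nbhs_left_lt.
have : `|F (nat_root k r) - F y| <= e by near: y.
rewrite ler_norml /F /tail => /andP[_].
by set a := limit_tail _ _; set b := limit_tail _ _; lra.
Unshelve. all: by end_near. Qed.

Variable m : nat -> R.
Hypothesis m_lim : forall k, gmean p n (fun x => x ^+ k) @[n --> \oo] --> m k.

Lemma moment_bounded k :
  exists M : R, forall n, gmean p n (fun x => x ^+ k) <= M.
Proof.
have /cvg_seq_bounded := cvgP _ (@m_lim k).
move=> /pinfty_ex_gt0[M M0 H]; exists M => n.
by apply: le_trans (H n I); exact: ler_norm.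
Qed.

(** Integrate the tails of the [k]-th powers. Dominated convergence identifies
    the moments of the limit law with the limits of the moments. *)
Lemma expectation_pos_partX k : (0 < k)%N ->
  ('E_P[(fun w => pos_part w ^+ k)%R] = (m k)%:E)%E.
Proof.
move=> k0.
have mX : measurable_fun setT (fun w => pos_part w ^+ k).
  by apply: measurable_funX; exact: measurable_pos_part.
pose X : {RV P >-> R} := mfun_Sub (mem_set mX).
have -> : ('E_P[(fun w => pos_part w ^+ k)%R] = 'E_P[X])%E by [].
have pp0 w : 0 <= pos_part w by rewrite le_max lexx orbT.
rewrite ge0_expectation_ccdf; last by move=> w; rewrite exprn_ge0.
have cX r : r \in (`[0%R, +oo[%classic : set R) -> ccdf X r = (tail (nat_root k r))%:E.
  rewrite inE /= in_itv /= andbT => r0.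
  rewrite ccdf_1_cdf -[tail _](subKr 1) EFinB -cdf_pos_part; congr (_ - _)%E.
  rewrite /cdf /distribution /pushforward; congr (P _).
  apply/seteqP; split=> w /=; rewrite !in_itv /= !leNgt => h;
    by rewrite ?ltr_nat_root // -?ltr_nat_root.
transitivity (\int[mu]_(r in `[0%R, +oo[) (tail (nat_root k r))%:E)%E.
  by apply: eq_integral => r rD; exact: cX.
have [M HM] := moment_bounded (k * 2).
pose D : set R := `[0%R, +oo[%classic.
have M1 : 0 <= 1 + M.
  apply: addr_ge0 => //; apply: le_trans (HM 0%N).
  apply: mean_ge0; [exact: scale_ge0|exact: is_pgf_generation|].
  by move=> x x0; rewrite exprn_ge0.
have [] := @dominated_convergence _ _ _ mu D _
    (fun n r => (power_tail n k r)%:E) (fun r => (tail (nat_root k r))%:E)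
    (fun r => ((1 + M) * (oneDsqr r)^-1)%:E).
- exact: measurable_itv.
- move=> n; apply/measurable_EFinP; apply: measurable_funTS.
  exact: measurable_power_tail.
- apply: (eq_measurable_fun (ccdf X)) => [r rD|]; first by rewrite cX.
  by apply: measurable_funTS; exact: ccdf_measurable.
- exact: ae_power_tail_cvg.
- under eq_fun do rewrite EFinM.
  apply: integrableZl; first exact: measurable_itv.
  apply/integrableP; split.
    apply/measurable_EFinP/measurable_funTS.
    by apply: continuous_measurable_fun; exact: continuous_oneDsqrV.
  have := @integral0y_oneDsqr R; rewrite -/D => intD.
  apply: (@le_lt_trans _ _ (pi / 2)%:E); last exact: ltry.
  rewrite -intD le_eqVlt; apply/orP; left; apply/eqP/eq_integral => r _.
  by rewrite gee0_abs // lee_fin invr_ge0 (le_trans ler01) // oneDsqr_ge1.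
- apply: aeW => r n; rewrite /D /= in_itv /= andbT => r0.
  have /andP[t0 t1] := power_tail_le r0 (HM n).
  by rewrite lee_fin ger0_norm.
move=> _ _ /=; under eq_fun do rewrite integral_power_tail.
move=> C; apply: (cvg_unique _ C) => //.
by apply/cvg_EFin; [exact: nearW | exact: m_lim].
Qed.

End GenerationMoment.

(** * Convergence in distribution *)

Lemma mean_cycle_poly (R : realFieldType) (c : R) (phi : R -> R) n
    (B : {set 'S_n}) :
  mean c phi (cycle_poly R B) = \sum_(s in B) phi (c * (cycle_count s)%:R).
Proof. by rewrite mean_sum; apply: eq_bigr => s _; rewrite meanXn. Qed.

Lemma sum_butterfly (R : realType) (p n : nat) (phi : R -> R) : prime p ->
  #|butterfly p n|%:R^-1 * \sum_(s in butterfly p n) phi (scaled_cycle_count R s) =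
  gmean p n phi.
Proof.
move=> pp.
have b0 : #|butterfly p n|%:R != 0 :> R.
  rewrite pnatr_eq0 -lt0n; apply/card_gt0P; exists 1%g.
  by case/group_setP: (group_set_butterfly p n).
have -> : \sum_(s in butterfly p n) phi (scaled_cycle_count R s) =
    #|butterfly p n|%:R * gmean p n phi.
  rewrite /gmean -meanZ -cycle_poly_butterfly // mean_cycle_poly.
  by apply: eq_bigr => s _; rewrite /scaled_cycle_count mulrC.
by rewrite mulKf.
Qed.

(** Only the law of [sigma] matters: each of the finitely many permutations has
    its uniform weight. *)
Lemma cdf_uniform_butterfly (R : realType) (p n : nat) (d : measure_display)
    (Omega : measurableType d) (P : probability Omega R)
    (sigma : {RV P >-> 'S_(p ^ n)}) x : prime p ->
    uniform_on sigma (butterfly p n) ->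
  cdf (@scaled_cycle_count R p n \o sigma : {RV P >-> R}) x =
  (lower_tail p n x)%:E.
Proof.
move=> pp unif.
pose Q (s : 'S_(p ^ n)) := scaled_cycle_count R s <= x.
have finQ : finite_set ([set` Q] : set 'S_(p ^ n)) by exact: finite_finset.
transitivity (distribution P sigma (\bigcup_(s in [set` Q]) [set s])).
  rewrite /cdf /distribution /pushforward; congr (P _); apply/seteqP; split=> w /=.
    by rewrite in_itv /= => h; exists (sigma w).
  by case=> s /= Qs ->; rewrite in_itv.
rewrite measure_fin_bigcup //; last by move=> s t _ _ [u [/= -> ->]].
rewrite -(@bigfs _ _ _ _ (index_enum _)) ?index_enum_uniq //; last first.
  by move=> s _; rewrite mem_index_enum.
rewrite /lower_tail -sum_butterfly // mulr_sumr -sumEFin.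
rewrite big_mkcond [RHS]big_mkcond; apply: eq_bigr => s _ /=.
rewrite unif /Q; case: leP => _; case: ifP => _ //; rewrite ?mulr1 ?mulr0 //.
Qed.

Theorem theorem11 (R : realType) (p : nat) (hp : prime p) (m : nat -> R)
    (hm0 : m 0%N = 1) (hm1 : m 1%N = 1)
    (hm : forall k : nat, (2 <= k)%N ->
      m k = (p%:R - 1)^-1 * ((lambda R p - 1) / (lambda R p ^+ k - lambda R p)) *
        \sum_(i : {ffun 'I_p -> 'I_k} | (\sum_(l < p) i l == k)%N)
          ((k`!)%:R / (\prod_(l < p) (i l)`!)%N%:R * \prod_(l < p) m (i l))) :
  exists (d : measure_display) (Omega : measurableType d)
      (P : probability Omega R) (W : {RV P >-> R}),
    [/\ (forall (dn : nat -> measure_display)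
           (Omegan : forall n, measurableType (dn n))
           (Pn : forall n, probability (Omegan n) R)
           (sigma : forall n, {RV (Pn n) >-> 'S_(p ^ n)}),
           (forall n, (1 <= n)%N -> uniform_on (sigma n) (butterfly p n)) ->
           cvg_in_distribution
             (fun n => (@scaled_cycle_count R p n \o sigma n : {RV (Pn n) >-> R}))
             W),
        P [set w | 0 < W w] = 1%E
      & forall k : nat, (1 <= k)%N ->
          ('E_P[(fun w => W w ^+ k)%R] = (m k)%:E)%E].
Proof.
have p1 := prime_gt1 hp.
have m_lim := gmean_expr_cvg p1 hm0 hm1 hm.
have [P P_cdf] := limit_law R p1.
have [M HM] := moment_bounded m_lim 2.
have cdfW := cdf_pos_part p1 P_cdf.
exists _, (measurableTypeR R), P, (@pos_part R : {RV P >-> R}); split.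
- move=> dn Omegan Pn sigma unif x cont.
  have : (lower_tail p n x)%:E @[n --> \oo] --> cdf (@pos_part R : {RV P >-> R}) x.
    rewrite cdfW; apply/cvg_EFin; first exact: nearW.
    apply: lower_tail_cvg => // e e0.
    have C : 1 - tail p y @[y --> x] --> 1 - tail p x.
      have : (1 - tail p y)%:E @[y --> x] --> (1 - tail p x)%:E.
        by rewrite -cdfW; under eq_fun do rewrite -cdfW; exact: cont.
      exact: fine_cvg.
    move/cvgrPdist_le: C => /(_ e e0) C.
    have {C} : \forall y \near x^'-, `|1 - tail p x - (1 - tail p y)| <= e.
      exact: cvg_within C.
    move=> C; near x^'- => y.
    exists y; first by near: y; exact: nbhs_left_lt.
    have : `|1 - tail p x - (1 - tail p y)| <= e by near: y.
    by rewrite ler_norml => /andP[_]; lra.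
  apply: cvg_trans; apply: near_eq_cvg; exists 1%N => // n /= n1.
  by rewrite cdf_uniform_butterfly //; exact: unif.
- have M1 : 0 < Num.max M 1 by rewrite lt_max ltr01 orbT.
  have t0 : tail p (0 : R) = 1.
    by apply: (tail0 p1 M1) => n; rewrite le_max HM.
  transitivity (ccdf (@pos_part R : {RV P >-> R}) 0).
    rewrite /ccdf /distribution /pushforward; congr (P _).
    by apply/seteqP; split=> w /=; rewrite in_itv /= andbT.
  by rewrite ccdf_1_cdf cdfW t0 subrr sube0.
- by move=> k; exact: (expectation_pos_partX p1 P_cdf m_lim).
Unshelve. all: by end_near. Qed.
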